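(* Let $\mathbb{F}\in\{\mathbb{R},\mathbb{C}\}$. There exist constants $c>0$ and $\gamma>0$ such that the following holds for all positive integers $n,m$ with $m\ge c\,n\log n$ and every $\mathbf{x}_0\in\mathbb{F}^n$. Let $\mathbf{z}_1,\dots,\mathbf{z}_m$ be independent random vectors, each uniformly distributed on the unit sphere of $\mathbb{F}^n$, let $\mathbf{X}_0=\mathbf{x}_0\mathbf{x}_0^*$ and let $\mathbf{b}=\mathcal{A}(\mathbf{X}_0)$, i.e. $b_i=|\langle \mathbf{x}_0,\mathbf{z}_i\rangle|^2$. Then, with probability at least $1-e^{-\gamma m/n}$, $\mathbf{X}=\mathbf{X}_0$ is the unique matrix $\mathbf{X}\in\mathcal{H}^{n\times n}$ satisfying $\mathbf{X}\succeq 0$ and $\mathcal{A}(\mathbf{X})=\mathbf{b}$.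
   Context: $\mathcal{H}^{n\times n}$ is the space of $n\times n$ Hermitian matrices over $\mathbb{F}$ (real symmetric matrices when $\mathbb{F}=\mathbb{R}$), and $\mathbf{X}\succeq 0$ means positive semidefinite. The linear operator $\mathcal{A}:\mathcal{H}^{n\times n}\to\mathbb{R}^m$ is $\mathcal{A}(\mathbf{X})=(\mathbf{z}_i^*\mathbf{X}\mathbf{z}_i)_{i=1,\dots,m}$. *)

(* Defs.v *)
From HB Require Import structures.
From mathcomp Require Import all_boot all_order all_algebra.
From mathcomp Require Import complex.
From mathcomp Require Import all_classical all_reals all_analysis.

Set Implicit Arguments.
Unset Strict Implicit.
Unset Printing Implicit Defensive.

Import Order.TTheory GRing.Theory Num.Theory.
Import numFieldNormedType.Exports.

Local Open Scope classical_set_scope.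
Local Open Scope ring_scope.
Local Open Scope complex_scope.
Local Open Scope sesquilinear_scope.

Inductive base_field := RealField | ComplexField.

Definition fieldF (R : realType) (K : base_field) : numFieldType :=
  match K with RealField => R | ComplexField => R[i] end.

Definition conjF (R : realType) (K : base_field) : fieldF R K -> fieldF R K :=
  match K with RealField => idfun | ComplexField => Num.conj end.

Arguments conjF {R K}.

(* Conjugate transpose; on column vectors, the inner product <u, v> (linear in
   u) is (adjF v *m u) 0 0. *)
Definition adjF (R : realType) (K : base_field) (p q : nat)
  (A : 'M[fieldF R K]_(p, q)) : 'M[fieldF R K]_(q, p) := A ^t conjF.

(* F^n with its Borel sigma-algebra. *)
Definition vecF (R : realType) (K : base_field) (n : nat) :=
  g_sigma_algebraType [set U : set 'cV[fieldF R K]_n | open U].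

(* The Euclidean sphere: the library norm `|u| of a matrix is the sup norm. *)
Definition unit_sphere (R : realType) (K : base_field) (n : nat) :
  set 'cV[fieldF R K]_n := [set u : 'cV_n | \sum_i `|u i 0| ^+ 2 = 1].

(* The uniform distribution on the sphere is its normalized Haar measure: the
   Borel probability carried by the sphere that is invariant under the group
   of linear isometries of F^n (orthogonal if F = R, unitary if F = C). *)
Definition uniform_on_sphere (R : realType) (K : base_field) (n : nat)
  (mu : set (vecF R K n) -> \bar R) : Prop :=
  mu (unit_sphere (n := n)) = 1%E /\
  forall (U : 'M[fieldF R K]_n) (B : set (vecF R K n)),
    U *m adjF U = 1%:M -> measurable B ->
    mu [set u : vecF R K n | B (U *m u)] = mu B.

Definition mutually_independent (R : realType) (d d' : measure_display)
  (T : measurableType d) (T' : measurableType d') (P : probability T R)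
  (I : finType) (X : I -> {RV P >-> T'}) : Prop :=
  forall (J : {set I}) (B : I -> set T'), (forall i, measurable (B i)) ->
    P [set w | forall i, i \in J -> B i (X i w)] =
    (\prod_(i in J) P [set w | B i (X i w)])%E.

Definition psd (R : realType) (K : base_field) (n : nat)
  (X : 'M[fieldF R K]_n) : Prop :=
  forall v : 'cV[fieldF R K]_n, 0 <= (adjF v *m X *m v) 0 0.

(* The values z_i^* X z_i are real when X is Hermitian; they are kept in F
   instead of being projected to R. *)
Definition measurement (R : realType) (K : base_field) (n m : nat)
  (z : 'I_m -> 'cV[fieldF R K]_n) (X : 'M[fieldF R K]_n) :
  'rV[fieldF R K]_m := \row_i (adjF (z i) *m X *m z i) 0 0.

Lemma measurement_rank1 (R : realType) (K : base_field) (n m : nat)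
  (z : 'I_m -> 'cV[fieldF R K]_n) (x : 'cV[fieldF R K]_n) (i : 'I_m) :
  measurement z (x *m adjF x) 0 i = `|(adjF (z i) *m x) 0 0| ^+ 2.
Proof.
have conjK (a : fieldF R K) : a * conjF a = `|a| ^+ 2.
  case: K a {z x} => /= a; last by rewrite normCK.
  by rewrite real_normK ?num_real// expr2.
have conjE (u v : 'cV[fieldF R K]_n) :
    (adjF u *m v) 0 0 = conjF ((adjF v *m u) 0 0).
  rewrite /adjF; case: K z x u v {conjK} => /= z x u v.
    by rewrite !mxE; apply: eq_bigr => j _; rewrite !mxE mulrC.
  rewrite !mxE rmorph_sum; apply: eq_bigr => j _.
  by rewrite !mxE rmorphM /= conjCK mulrC.
rewrite mxE mulmxA -mulmxA mxE big_ord1 [X in _ * X = _]conjE.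
exact: conjK.
Qed.

(* Main.v *)
Require Import Defs.
From HB Require Import structures.
From mathcomp Require Import all_boot all_order all_algebra.
From mathcomp Require Import complex ring lra.
From mathcomp Require Import all_classical all_reals all_analysis.
From mathcomp Require Import measurable_realfun.

Set Implicit Arguments.
Unset Strict Implicit.
Unset Printing Implicit Defensive.

Import Order.TTheory GRing.Theory Num.Theory.
Import numFieldNormedType.Exports.

Local Open Scope classical_set_scope.
Local Open Scope ring_scope.

(** Put H = X - X0, where X is feasible.  H vanishes on every z_i, and it is
    nonnegative on the orthogonal complement of x0, so that it has at most one
    negative eigenvalue ([one_negative_eigenvalue]).  If it has none, it vanishes
    as soon as no direction is orthogonal to all the z_i.  Otherwise, after
    scaling, H = K - y y^* with y a unit vector, K positive semidefinite, K y = 0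
    and z_i^* K z_i = |<y, z_i>|^2 for all i.  The proof shows that with high
    probability no y and K are balanced in this way ([no_balanced_form]); in
    particular the exceptional event does not depend on x0.

    Write s = n |<y, z>|^2 and t = n |<u, z>|^2 for a unit vector u orthogonal
    to y.  On the sphere s and t are exchangeable, of mean 1 and of second moment
    at most 3.  Two families of test functions of (s, t) exclude a balanced K.

    - With a decreasing weight phi, exchangeability gives
      E phi(s) (t - s) = E (phi(s) - phi(t)) (t - s) / 2, which is bounded below
      by a positive constant ([Ex_anticorrelation]).  Applied to all eigenvectors
      u of K, this forces the trace of K below some kap < 1.

    - Let v be the sum of the eigenvectors of K, scaled by the square roots of
      the eigenvalues, with random signs.  Then |v|^2 is the trace of K, the mean
      of |<v, z_i>|^2 is z_i^* K z_i, and its second moment is at most three times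
      the square of the mean, so that a truncation at a large M is harmless: for
      some choice of signs ([signed_sum]) a weighted sum of the
      min(|<v, z_i>|^2, M) is almost that of the |<y, z_i>|^2.  But for each single
      v the ratio of their means is about kap.

    The signs are what makes a union bound affordable: a net for the matrices K
    would have about exp(n^2 log n) points, while a net for the pairs (y, v) of
    polynomial mesh has exp(C n log n).  The tests are bounded and Lipschitz and
    have means bounded below ([Ex_trace_test], [Ex_sign_test]), so that each pair
    of the net fails with probability exp(- c m) only, by a Chernoff bound for
    counts ([count_lower_tail]) applied to the level sets of the test.  This gives
    the law of large numbers [uniform_law], uniform over all orthonormal pairs,
    and m >= c n log n absorbs the size of the net.  The failure probability is
    thus even exponentially small in m. *)

(** * The two base fields *)

Section BaseField.
Variables (R : realType) (K : base_field).
Local Notation F := (fieldF R K).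

Definition embF : R -> F :=
  match K return R -> fieldF R K with
  | RealField => fun r : R => r
  | ComplexField => fun r : R => real_complex R r
  end.

Definition reF : F -> R :=
  match K return fieldF R K -> R with
  | RealField => fun a : R => a
  | ComplexField => fun a : R[i] => complex.Re a
  end.

Definition nsq : F -> R :=
  match K return fieldF R K -> R with
  | RealField => fun a : R => a ^+ 2
  | ComplexField => fun a : R[i] => (complex.Re a) ^+ 2 + (complex.Im a) ^+ 2
  end.

(** A second phase for polarization; it has to be 1 over the reals, where the
    imaginary part that it would detect vanishes. *)
Definition quarter : F :=
  match K return fieldF R K with
  | RealField => (1 : R)
  | ComplexField => Complex (0 : R) 1
  end.

End BaseField.

Arguments embF {R K}.
Arguments reF {R K}.
Arguments nsq {R K}.

Section BaseFieldTheory.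
Variables (R : realType) (K : base_field).
Local Notation F := (fieldF R K).
Implicit Types a b : F.

Fact conjF_zmod : zmod_morphism (@conjF R K).
Proof. by case: K => x y //=; exact: rmorphB. Qed.
Fact conjF_monoid : monoid_morphism (@conjF R K).
Proof. by case: K; split => //=; [exact: rmorph1 | exact: rmorphM]. Qed.
HB.instance Definition _ := GRing.isZmodMorphism.Build F F (@conjF R K) conjF_zmod.
HB.instance Definition _ := GRing.isMonoidMorphism.Build F F (@conjF R K) conjF_monoid.

Fact embF_zmod : zmod_morphism (@embF R K).
Proof. by case: K => x y //=; exact: rmorphB. Qed.
Fact embF_monoid : monoid_morphism (@embF R K).
Proof. by case: K; split => //=; exact: rmorphM. Qed.
HB.instance Definition _ := GRing.isZmodMorphism.Build R F (@embF R K) embF_zmod.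
HB.instance Definition _ := GRing.isMonoidMorphism.Build R F (@embF R K) embF_monoid.

Fact reF_zmod : zmod_morphism (@reF R K).
Proof. by case: K => x y //=; rewrite raddfB. Qed.
HB.instance Definition _ := GRing.isZmodMorphism.Build F R (@reF R K) reF_zmod.

Lemma conjFK : involutive (@conjF R K).
Proof. by case: K => a //=; rewrite conjCK. Qed.

Lemma conjF_emb (r : R) : conjF (embF r : F) = embF r.
Proof. by case: K => //=; apply: conjc_real. Qed.

Lemma embF_le (r s : R) : ((embF r : F) <= embF s) = (r <= s).
Proof. by case: K => //=; rewrite lecR. Qed.

Lemma reF_emb (r : R) : reF (embF r : F) = r.
Proof. by case: K. Qed.

Lemma embF_inj : injective (@embF R K).
Proof. by move=> r s /(congr1 reF); rewrite !reF_emb. Qed.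

Lemma embF_eq0 (r : R) : (embF r == 0 :> F) = (r == 0).
Proof. by rewrite -(rmorph0 (@embF R K)) (inj_eq embF_inj). Qed.

Lemma real_emb a : conjF a = a -> a = embF (reF a).
Proof.
case: K a => //= a /CrealP /complex_realP[r ->] //.
Qed.

Lemma reF_conj a : reF (conjF a) = reF a.
Proof. by case: K a => //= -[]. Qed.

Lemma nsqE a : embF (nsq a) = a * conjF a.
Proof.
case: K a => [a|a]; first exact: expr2.
by rewrite -normCK -add_Re2_Im2.
Qed.

Lemma nsq_norm a : embF (nsq a) = `|a| ^+ 2.
Proof.
case: K a => /= a; first by rewrite real_normK ?num_real.
by rewrite add_Re2_Im2.
Qed.

Lemma nsq_ge0 a : 0 <= nsq a.
Proof. by case: K a => /= a; rewrite ?addr_ge0 ?sqr_ge0. Qed.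

Lemma nsq_eq0 a : nsq a = 0 -> a = 0.
Proof.
move=> h; have := nsq_norm a; rewrite h rmorph0 => /esym/eqP.
by rewrite sqrf_eq0 normr_eq0 => /eqP.
Qed.

Lemma nsq0 : nsq (0 : F) = 0.
Proof. by apply: embF_inj; rewrite nsqE mul0r rmorph0. Qed.

Lemma nsqM a b : nsq (a * b) = nsq a * nsq b.
Proof. by apply: embF_inj; rewrite rmorphM /= !nsqE rmorphM /= mulrACA. Qed.

Lemma nsq_conj a : nsq (conjF a) = nsq a.
Proof. by apply: embF_inj; rewrite !nsqE conjFK mulrC. Qed.

Lemma nsqN a : nsq (- a) = nsq a.
Proof. by apply: embF_inj; rewrite !nsqE rmorphN /= mulrNN. Qed.

Lemma nsq_emb (r : R) : nsq (embF r : F) = r ^+ 2.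
Proof. by apply: embF_inj; rewrite nsqE conjF_emb rmorphXn. Qed.

Lemma nsq1 : nsq (1 : F) = 1.
Proof. by rewrite -(rmorph1 embF) nsq_emb expr1n. Qed.

Lemma nsqD a b : nsq (a + b) = nsq a + nsq b + 2 * reF (a * conjF b).
Proof.
case: K a b => /= a b; first by ring.
by case: a b => [a1 a2] [b1 b2] /=; ring.
Qed.

Lemma nsqB a b : nsq (a - b) = nsq a + nsq b - 2 * reF (a * conjF b).
Proof. by rewrite nsqD nsqN rmorphN mulrN raddfN mulrN. Qed.

Lemma re_sq_le a b : reF (a * conjF b) ^+ 2 <= nsq a * nsq b.
Proof.
case: K a b => /= a b; first by rewrite exprMn.
case: a b => [a1 a2] [b1 b2] /=; rewrite -subr_ge0.
set l := (X in 0 <= X); have -> : l = (a1 * b2 - a2 * b1) ^+ 2 by rewrite /l; ring.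
exact: sqr_ge0.
Qed.

Lemma nsq_quarter : nsq (quarter R K) = 1.
Proof. by case: K; rewrite /= ?expr1n ?expr0n ?add0r. Qed.

(** The three real numbers on the right are the Hopf coordinates of the pair
    (a, b); over the reals two of them coincide, whence the inequality. *)
Lemma hopf_le a b :
  (nsq a + nsq b) ^+ 2 <=
  (nsq a - nsq b) ^+ 2 + (2 * reF (a * conjF b)) ^+ 2
    + (2 * reF (a * conjF (quarter R K * b))) ^+ 2.
Proof.
rewrite -subr_ge0; case: K a b => /= a b.
  set l := (X in 0 <= X); have -> : l = (2 * a * b) ^+ 2 by rewrite /l; ring.
  exact: sqr_ge0.
case: a b => [a1 a2] [b1 b2] /=.
by set l := (X in 0 <= X); have -> : l = 0 by rewrite /l; ring.
Qed.

End BaseFieldTheory.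

(** * Inner product and reflections *)

Section InnerProduct.
Variables (R : realType) (K : base_field).
Local Notation F := (fieldF R K).

Section Dim.
Variable n : nat.
Implicit Types (u v w y z : 'cV[F]_n) (U : 'M[F]_n) (a : F).

Definition ip u v : F := (adjF u *m v) 0 0.
Definition sqn u : R := \sum_k nsq (u k 0).

Lemma adjFE p q (A : 'M[F]_(p, q)) i j : adjF A i j = conjF (A j i).
Proof. by rewrite !mxE. Qed.

Lemma adjFK p q (A : 'M[F]_(p, q)) : adjF (adjF A) = A.
Proof. by apply/matrixP => i j; rewrite !adjFE conjFK. Qed.

Lemma adjFM p q r (A : 'M[F]_(p, q)) (B : 'M[F]_(q, r)) :
  adjF (A *m B) = adjF B *m adjF A.
Proof.
apply/matrixP => i j; rewrite adjFE !mxE rmorph_sum; apply: eq_bigr => k _ /=.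
by rewrite rmorphM /= !mxE mulrC.
Qed.

Lemma adjFD p q (A B : 'M[F]_(p, q)) : adjF (A + B) = adjF A + adjF B.
Proof. by apply/matrixP => i j; rewrite !mxE rmorphD. Qed.

Lemma adjFZ p q a (A : 'M[F]_(p, q)) : adjF (a *: A) = conjF a *: adjF A.
Proof. by apply/matrixP => i j; rewrite !mxE rmorphM. Qed.

Lemma adjF1 : adjF (1%:M : 'M[F]_n) = 1%:M.
Proof. by apply/matrixP => i j; rewrite !mxE eq_sym rmorph_nat. Qed.

Lemma ipE u v : ip u v = \sum_k conjF (u k 0) * v k 0.
Proof. by rewrite /ip mxE; apply: eq_bigr => k _; rewrite !mxE. Qed.

Lemma ip_conj u v : conjF (ip u v) = ip v u.
Proof.
rewrite !ipE rmorph_sum; apply: eq_bigr => k _ /=.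
by rewrite rmorphM /= conjFK mulrC.
Qed.

Lemma ipDr u v w : ip u (v + w) = ip u v + ip u w.
Proof. by rewrite /ip mulmxDr mxE. Qed.
Lemma ipZr a u v : ip u (a *: v) = a * ip u v.
Proof. by rewrite /ip -scalemxAr mxE. Qed.
Lemma ipDl u v w : ip (u + v) w = ip u w + ip v w.
Proof. by rewrite /ip adjFD mulmxDl mxE. Qed.
Lemma ipZl a u v : ip (a *: u) v = conjF a * ip u v.
Proof. by rewrite /ip adjFZ -scalemxAl mxE. Qed.
Lemma ipNr u v : ip u (- v) = - ip u v.
Proof. by rewrite -scaleN1r ipZr mulN1r. Qed.
Lemma ipNl u v : ip (- u) v = - ip u v.
Proof. by rewrite -scaleN1r ipZl rmorphN1 mulN1r. Qed.
Lemma ip0r u : ip u 0 = 0.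
Proof. by rewrite -(scale0r 0) ipZr mul0r. Qed.
Lemma ip0l u : ip 0 u = 0.
Proof. by rewrite -ip_conj ip0r rmorph0. Qed.

Lemma ip_self u : ip u u = embF (sqn u).
Proof.
rewrite ipE rmorph_sum; apply: eq_bigr => k _ /=.
by rewrite nsqE mulrC.
Qed.

Lemma sqn_ge0 u : 0 <= sqn u.
Proof. by apply: sumr_ge0 => k _; exact: nsq_ge0. Qed.

Lemma sqn_eq0 u : sqn u = 0 -> u = 0.
Proof.
move=> /eqP; rewrite psumr_eq0 => [|k _]; last exact: nsq_ge0.
move=> /allP h; apply/colP => k; rewrite mxE; apply: nsq_eq0; apply/eqP.
by apply: h; rewrite mem_index_enum.
Qed.

Lemma sqn0 : sqn 0 = 0.
Proof. by apply: (@embF_inj R K); rewrite -ip_self ip0r rmorph0. Qed.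

Lemma sqn_eq0E u : (sqn u == 0) = (u == 0).
Proof. by apply/eqP/eqP => [/sqn_eq0//|->]; exact: sqn0. Qed.

Lemma sqnZ a u : sqn (a *: u) = nsq a * sqn u.
Proof.
by apply: (@embF_inj R K); rewrite rmorphM /= -!ip_self ipZr ipZl nsqE mulrA.
Qed.

Lemma sqnD u v : sqn (u + v) = sqn u + sqn v + 2 * reF (ip u v).
Proof.
rewrite /sqn ipE raddf_sum mulr_sumr -!big_split /=; apply: eq_bigr => k _.
rewrite mxE nsqD; congr (_ + 2 * _).
by rewrite -reF_conj rmorphM /= conjFK.
Qed.

Lemma sqnB u v : sqn (u - v) = sqn u + sqn v - 2 * reF (ip u v).
Proof.
rewrite sqnD ipNr raddfN mulrN; congr (_ + _ + _).
by rewrite -scaleN1r sqnZ nsqN nsq1 mul1r.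
Qed.

Lemma sqnD_orth u v : ip u v = 0 -> sqn (u + v) = sqn u + sqn v.
Proof. by move=> uv; rewrite sqnD uv raddf0 mulr0 addr0. Qed.

Lemma ip_unitary U u v : U *m adjF U = 1%:M -> ip (U *m u) (U *m v) = ip u v.
Proof.
move=> /mulmx1C UU; rewrite /ip adjFM -mulmxA (mulmxA (adjF U)) UU mul1mx //.
Qed.

Lemma sqn_unitary U u : U *m adjF U = 1%:M -> sqn (U *m u) = sqn u.
Proof. by move=> UU; apply: (@embF_inj R K); rewrite -!ip_self ip_unitary. Qed.

Lemma ip_adj U u v : ip u (U *m v) = ip (adjF U *m u) v.
Proof. by rewrite /ip adjFM adjFK mulmxA. Qed.

Lemma cauchy_schwarz u v : nsq (ip u v) <= sqn u * sqn v.
Proof.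
have [u0|u0] := eqVneq (sqn u) 0.
  by rewrite (sqn_eq0 u0) ip0l nsq0 sqn0 mul0r.
have up : 0 < sqn u by rewrite lt0r u0 sqn_ge0.
have := sqn_ge0 (embF (sqn u) *: v - ip u v *: u).
rewrite sqnB !sqnZ nsq_emb ipZr ipZl conjF_emb mulrA.
have -> : ip v u = conjF (ip u v) by rewrite ip_conj.
rewrite (mulrAC (ip u v)) -nsqE -rmorphM reF_emb.
have -> : sqn u ^+ 2 * sqn v + nsq (ip u v) * sqn u -
  2 * (nsq (ip u v) * sqn u) = sqn u * (sqn u * sqn v - nsq (ip u v)) by ring.
by rewrite pmulr_rge0// subr_ge0.
Qed.

Definition orthonormal2 y u := [/\ sqn y = 1, sqn u = 1 & ip y u = 0].

(** The reflection in the hyperplane orthogonal to y - y' does this; the condition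
    is that the inner product be real, which is automatic over the reals only. *)
Lemma reflection y y' : sqn y = 1 -> sqn y' = 1 -> ip y y' = ip y' y ->
  exists U, [/\ U *m adjF U = 1%:M, adjF U = U, U *m y = y' & U *m y' = y].
Proof.
move=> ny ny' re.
have [e|ne] := eqVneq y y'.
  by exists 1%:M; rewrite !mul1mx adjF1 e.
set w := y - y'.
have w0 : sqn w != 0 by rewrite sqn_eq0E subr_eq0.
have c0 : embF (sqn w) != 0 :> F.
  by rewrite embF_eq0.
set c : F := 2 / embF (sqn w).
have cc : conjF c = c by rewrite /c rmorphM fmorphV /= conjF_emb rmorph_nat.
pose U := 1%:M - c *: (w *m adjF w).
have Uv v : U *m v = v - (c * ip w v) *: w.
  rewrite mulmxBl mul1mx -scalemxAl -mulmxA (mx11_scalar (adjF w *m v)).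
  by rewrite -/(ip w v) mul_mx_scalar scalerA.
have sw : embF (sqn w) = 2 * (1 - ip y y').
  rewrite -ip_self /w ipDl !ipDr !ipNl !ipNr -re !ip_self ny ny' rmorph1.
  by ring.
have Uy : U *m y = y'.
  rewrite Uv; have -> : c * ip w y = 1.
    have -> : ip w y = 1 - ip y y' by rewrite /w ipDl ipNl ip_self ny rmorph1 -re.
    by rewrite /c mulrAC -sw mulfV.
  by rewrite scale1r /w opprB addrC subrK.
have UH : adjF U = U.
  rewrite /U adjFD -scaleN1r adjFZ rmorphN1 scaleN1r adjFZ cc adjFM adjFK.
  by rewrite adjF1 scaleN1r.
have UU : U *m U = 1%:M.
  apply/matrixP => i j; pose e : 'cV[F]_n := delta_mx j 0.
  suff : U *m (U *m e) = e.
    move=> /matrixP/(_ i 0); rewrite mulmxA -colE !mxE => ->.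
    by rewrite eqxx andbT.
  rewrite [X in U *m X]Uv Uv ipDr ipNr ipZr ip_self -addrA -opprD -scalerDl.
  suff -> : c * ip w e + c * (ip w e - c * ip w e * embF (sqn w)) = 0.
    by rewrite scale0r subr0.
  have cE : c * embF (sqn w) = 2 by rewrite /c divfK.
  have -> (x : F) : c * x + c * (x - c * x * embF (sqn w)) =
      c * x * (2 - c * embF (sqn w)) by ring.
  by rewrite cE subrr mulr0.
exists U; split => //; first by rewrite UH.
by rewrite -Uy mulmxA UU mul1mx.
Qed.

End Dim.
End InnerProduct.

(** * Spectral decomposition of Hermitian matrices *)

Section Spectral.
Variables (R : realType) (K : base_field).
Local Notation F := (fieldF R K).

(** A nonzero Hermitian matrix is not nilpotent: its diagonal form has a nonzero
    entry. *)
Lemma complex_hermitian_eigenvector n (H : 'M[R[i]]_n) :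
  map_mx Num.conj H^T = H -> H != 0 ->
  exists (a : R[i]) (y : 'cV[R[i]]_n), [/\ a != 0, y != 0 & H *m y = a *: y].
Proof.
move=> Hh H0.
have /orthomx_spectralP HE : H \is normalmx.
  by apply: hermitian_normalmx; apply/is_hermitianmxP; rewrite expr0 scale1r Hh.
set P := spectralmx H in HE; set D := spectral_diag H in HE.
have Pu : P \in unitmx by exact: spectral_unit.
have [i Di] : exists i, D 0 i != 0.
  apply/existsP; apply: contraNT H0; rewrite negb_exists => /forallP D0.
  rewrite HE; suff -> : diag_mx D = 0 by rewrite mulmx0 mul0mx.
  by apply/matrixP => i j; rewrite !mxE (eqP (negbNE (D0 i))) mul0rn.
exists (D 0 i), (invmx P *m delta_mx i 0); split => //.
- apply/eqP => /(congr1 (mulmx P)); rewrite mulKVmx// mulmx0 => /matrixP/(_ i 0).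
  by rewrite !mxE !eqxx => /eqP; rewrite oner_eq0.
- rewrite {1}HE -!mulmxA (mulmxA P) mulmxV// mul1mx scalemxAr; congr (_ *m _).
  apply/colP => j; rewrite mul_diag_mx !mxE; case: eqP => [->|] //=.
  by rewrite !mulr0.
Qed.

(** Over the reals, the eigenvalue is found over the complex numbers; it is real,
    hence a root of the real characteristic polynomial. *)
Lemma hermitian_eigenvector n (H : 'M[F]_n) : adjF H = H -> H != 0 ->
  exists (a : F) (y : 'cV[F]_n), [/\ a != 0, y != 0 & H *m y = a *: y].
Proof.
case: K H => H; last exact: complex_hermitian_eigenvector.
move=> Hh H0; pose Hc := map_mx (real_complex R) H.
have HT : H^T = H by rewrite -{2}Hh /adjF /conjF map_mx_id.
have HcH : map_mx Num.conj Hc^T = Hc.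
  rewrite /Hc map_trmx HT -map_mx_comp; apply: eq_map_mx => r /=.
  exact: conjc_real.
have [|a [y [a0 y0 Hy]]] := complex_hermitian_eigenvector HcH.
  by rewrite map_mx_eq0.
have HcT : Hc^T = Hc by rewrite /Hc map_trmx HT.
have ea : eigenvalue Hc a.
  apply/eigenvalueP; exists y^T; last by rewrite trmx_eq0.
  by rewrite -{1}HcT -trmx_mul Hy linearZ.
have ar : conjF (K := ComplexField) a = a.
  have : ip (K := ComplexField) y (Hc *m y) = ip (K := ComplexField) (Hc *m y) y.
    have HcF : @adjF R ComplexField n n Hc = Hc := HcH.
    by rewrite ip_adj HcF.
  have sy : @embF R ComplexField (sqn (K := ComplexField) y) != 0.
    by rewrite embF_eq0 sqn_eq0E.
  by rewrite Hy ipZr ipZl ip_self => /(mulIf sy)/esym.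
move: (@reF R ComplexField a) (real_emb ar) => r aE; move: ea a0.
rewrite aE eigenvalue_root_char -map_char_poly fmorph_root -eigenvalue_root_char.
move=> /eigenvalueP[v vH v0] r0; exists r, v^T; split.
- by move: r0; rewrite (@embF_eq0 R ComplexField).
- by rewrite trmx_eq0.
- by rewrite -{1}HT -trmx_mul vH linearZ.
Qed.

Lemma hermitian_eigenpair n (H : 'M[F]_n) : adjF H = H -> H != 0 ->
  exists (l : R) (y : 'cV[F]_n),
    [/\ l != 0, sqn y = 1 & H *m y = embF l *: y].
Proof.
move=> Hh H0; have [a [y [a0 y0 Hy]]] := hermitian_eigenvector Hh H0.
have sy : sqn y != 0 by rewrite sqn_eq0E.
have ar : conjF a = a.
  have : ip y (H *m y) = ip (H *m y) y by rewrite ip_adj Hh.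
  have sy' : embF (sqn y) != 0 :> F by rewrite embF_eq0.
  by rewrite Hy ipZr ipZl ip_self => /(mulIf sy')/esym.
exists (reF a), (embF (Num.sqrt (sqn y))^-1 *: y); split.
- by apply: contra a0 => /eqP r0; rewrite (real_emb ar) r0 rmorph0.
- rewrite sqnZ nsq_emb exprVn sqr_sqrtr ?sqn_ge0// mulVf//.
- by rewrite -scalemxAr Hy !scalerA mulrC {1}(real_emb ar).
Qed.

Definition orthonormal_seq n (s : seq (R * 'cV[F]_n)) :=
  (forall p, p \in s -> sqn p.2 = 1) /\
  pairwise (fun p q => ip p.2 q.2 == 0) s.

Lemma rank1_mul n (y v : 'cV[F]_n) : y *m adjF y *m v = ip y v *: y.
Proof.
by rewrite -mulmxA (mx11_scalar (adjF y *m v)) -/(ip y v) mul_mx_scalar.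
Qed.

Lemma sum_rank1_mul n (s : seq (R * 'cV[F]_n)) v :
  (\sum_(q <- s) embF q.1 *: (q.2 *m adjF q.2)) *m v =
  \sum_(q <- s) (embF q.1 * ip q.2 v) *: q.2.
Proof.
rewrite mulmx_suml; apply: eq_bigr => q _.
by rewrite -scalemxAl rank1_mul scalerA.
Qed.

Lemma sum_rank1_eigen n (s : seq (R * 'cV[F]_n)) p :
  orthonormal_seq s -> p \in s ->
  (\sum_(q <- s) embF q.1 *: (q.2 *m adjF q.2)) *m p.2 = embF p.1 *: p.2.
Proof.
rewrite sum_rank1_mul; elim: s => // q s IH [ns /= /andP[/allP qs os]].
rewrite inE big_cons => /predU1P[->|ps].
  rewrite ip_self ns ?mem_head// rmorph1 mulr1 big_seq big1 ?addr0// => p' ps.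
  by rewrite -ip_conj (eqP (qs _ ps)) rmorph0 mulr0 scale0r.
rewrite (eqP (qs _ ps)) mulr0 scale0r add0r; apply: IH => //; split => //.
by move=> p' p's; apply: ns; rewrite inE p's orbT.
Qed.

Lemma quadratic_form_rank1 n (s : seq (R * 'cV[F]_n)) z :
  ip z ((\sum_(q <- s) embF q.1 *: (q.2 *m adjF q.2)) *m z) =
  embF (\sum_(q <- s) q.1 * nsq (ip q.2 z)).
Proof.
rewrite sum_rank1_mul rmorph_sum (big_morph (ip z) (ipDr z) (ip0r z)).
apply: eq_bigr => q _; rewrite ipZr rmorphM /= -mulrA; congr (_ * _).
by rewrite nsqE ip_conj.
Qed.

(** Subtracting an eigencomponent lowers the rank, and the eigenvectors of the
    remainder for nonzero eigenvalues are orthogonal to the one removed. *)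
Lemma spectral_decomposition n (H : 'M[F]_n) : adjF H = H ->
  exists s : seq (R * 'cV[F]_n),
    [/\ orthonormal_seq s, (forall p, p \in s -> p.1 != 0)
      & H = \sum_(p <- s) embF p.1 *: (p.2 *m adjF p.2)].
Proof.
have [r] := ubnP (\rank H); elim: r H => // r IH H rk Hh.
have [->|H0] := eqVneq H 0.
  by exists [::]; split => //; rewrite big_nil.
have [l [y [l0 ny Hy]]] := hermitian_eigenpair Hh H0.
have l0' : embF l != 0 :> F by rewrite embF_eq0.
pose Q := y *m adjF y; pose H' := H - embF l *: Q.
have yy : adjF y *m y = 1%:M.
  by rewrite (mx11_scalar (adjF y *m y)) -/(ip y y) ip_self ny rmorph1.
have yH : adjF y *m H = embF l *: adjF y.
  by rewrite -{1}Hh -adjFM Hy adjFZ conjF_emb.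
have H'y : H' *m y = 0.
  by rewrite mulmxBl Hy -scalemxAl -mulmxA yy mulmx1 subrr.
have Hh' : adjF H' = H'.
  by rewrite /H' -scaleN1r adjFD !adjFZ rmorphN1 conjF_emb adjFM adjFK Hh.
have sub : (H' <= H)%MS.
  apply/submxP; exists (1%:M - Q); rewrite mulmxBl mul1mx -mulmxA yH.
  by rewrite -scalemxAr.
have rk' : (\rank H' < r)%N.
  apply: leq_trans (rk : (\rank H <= r)%N); apply: rank_ltmx.
  rewrite ltmxE sub /=; apply/negP => sub'.
  have : (adjF y <= H')%MS.
    apply: submx_trans sub'; apply/submxP; exists ((embF l)^-1 *: adjF y).
    by rewrite -scalemxAl yH scalerA mulVf// scale1r.
  move=> /submxP[a ya]; move: yy; rewrite ya -mulmxA H'y mulmx0.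
  move=> /matrixP/(_ 0 0); rewrite !mxE eqxx => /esym/eqP.
  by rewrite oner_eq0.
have [s [[ns os] nz HE]] := IH H' rk' Hh'.
have H's p : p \in s -> ip y p.2 = 0.
  move=> ps.
  have H'p : H' *m p.2 = embF p.1 *: p.2.
    by rewrite HE sum_rank1_eigen.
  have : ip y (H' *m p.2) = 0 by rewrite ip_adj Hh' H'y ip0l.
  rewrite H'p ipZr => /eqP; rewrite mulf_eq0 embF_eq0 (negPf (nz p ps)).
  by move=> /eqP.
exists ((l, y) :: s); split.
- split => /=.
    by move=> p; rewrite inE => /predU1P[->//|/ns].
  by rewrite os andbT; apply/allP => p ps /=; rewrite H's.
- by move=> p; rewrite inE => /predU1P[->//|/nz].
- by rewrite big_cons /= -HE /H' addrC subrK.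
Qed.
End Spectral.

(** * Excluding balanced forms by test functions *)

Section TestFunctions.
Variable R : realType.
Implicit Types A M kap s t : R.

Definition cutoff A s : R := Num.max 0 (1 - s / A).

(** The truncations of s and t make both tests bounded and Lipschitz.  That of
    s costs nothing, since the cutoff vanishes beyond it. *)
Definition trace_test A kap M s t : R :=
  cutoff A s * (kap * Num.min t M - Num.min s A).

Definition sign_test kap M s t : R :=
  cutoff M s * (Num.min s M - 3 * Num.min s M ^+ 2 / (4 * M) - Num.min (kap * t) M).

Lemma cutoff_ge0 A s : 0 <= cutoff A s.
Proof. by rewrite /cutoff le_max lexx. Qed.

Lemma cutoff_eq0 A s : 0 < A -> A <= s -> cutoff A s = 0.
Proof.
move=> A0 As; apply/max_idPl.
by rewrite subr_le0 ler_pdivlMr// mul1r.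
Qed.

Lemma cutoff_min A s (h : R -> R) : 0 < A ->
  cutoff A s * h (Num.min s A) = cutoff A s * h s.
Proof.
move=> A0; have [sA|As] := leP s A; first by [].
by rewrite cutoff_eq0 ?mul0r// ltW.
Qed.

End TestFunctions.

Section Signs.
Variables (R : realType) (K : base_field).
Local Notation F := (fieldF R K).

(** The mean of t' - t'^2 / (4 M), where t' is the squared modulus of a number of
    squared modulus t perturbed by a centred Gaussian of variance Y and of the
    same phase.  The quadratic function lies below min(t', M). *)
Definition gauss_mean (M t Y : R) : R :=
  t + Y - (t ^+ 2 + 6 * t * Y + 3 * Y ^+ 2) / (4 * M).

Lemma gauss_mean_le_min (M t : R) : 0 < M -> gauss_mean M t 0 <= Num.min t M.
Proof.
move=> M0; rewrite /gauss_mean le_min.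
have -> : t + 0 - (t ^+ 2 + 6 * t * 0 + 3 * 0 ^+ 2) / (4 * M) = t - t ^+ 2 / (4 * M).
  by rewrite !mulr0 expr0n mulr0 !addr0.
have M4 : 0 < 4 * M by rewrite mulr_gt0.
apply/andP; split; first by rewrite gerBl divr_ge0 ?sqr_ge0// ltW.
rewrite lerBlDr -lerBlDl ler_pdivlMr//.
by have := sqr_ge0 (t - 2 * M); nra.
Qed.

(** Replacing a Gaussian increment by a symmetric sign does not lower the mean,
    because the fourth moment of the sign is the smaller one. *)
Lemma gauss_mean_split (M Y : R) (a b : F) : 0 < M ->
  2 * gauss_mean M (nsq a) (nsq b + Y) <=
  gauss_mean M (nsq (a + b)) Y + gauss_mean M (nsq (a - b)) Y.
Proof.
move=> M0; rewrite nsqD nsqB; have := re_sq_le a b.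
move: (reF _) (nsq a) (nsq b) => r al be h.
rewrite -subr_ge0 /gauss_mean; set D := (X in 0 <= X).
have -> : D = (8 * (al * be) + 4 * be ^+ 2 - 8 * r ^+ 2) / (4 * M).
  by rewrite /D; field; rewrite ?gt_eqF.
rewrite divr_ge0 ?mulr_ge0 ?(ltW M0)//.
by have := sqr_ge0 be; nra.
Qed.

Variables (n m : nat) (z : 'I_m -> 'cV[F]_n) (psi : 'I_m -> R) (M : R).
Hypotheses (psi_ge0 : forall i, 0 <= psi i) (M_gt0 : 0 < M).

Lemma sign_choice (v w : 'cV[F]_n) (Y : 'I_m -> R) :
  exists w', [/\ w' = w \/ w' = - w &
  \sum_i psi i * gauss_mean M (nsq (ip v (z i))) (nsq (ip w (z i)) + Y i) <=
  \sum_i psi i * gauss_mean M (nsq (ip (v + w') (z i))) (Y i)].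
Proof.
pose S := \sum_i psi i * gauss_mean M (nsq (ip v (z i))) (nsq (ip w (z i)) + Y i).
pose G u := \sum_i psi i * gauss_mean M (nsq (ip u (z i))) (Y i).
have : 2 * S <= G (v + w) + G (v - w).
  rewrite /S /G mulr_sumr -big_split /=; apply: ler_sum => i _.
  rewrite mulrCA -mulrDr ler_wpM2l// !ipDl ipNl.
  exact: gauss_mean_split.
have [h _|/ltW h1 h2] := leP S (G (v + w)); first by exists w; split => //; left.
exists (- w); split; first by right.
by rewrite -/(G (v - w)) -/S; move: h1 h2; lra.
Qed.

(** Derandomization: the signs are chosen one at a time, those still to be chosen
    being accounted for by a Gaussian of the same variance. *)
Lemma signed_sum (s : seq 'cV[F]_n) (v : 'cV[F]_n) :
  pairwise (fun u w => ip u w == 0) s -> (forall w, w \in s -> ip v w = 0) ->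
  exists v', [/\ sqn v' = sqn v + \sum_(w <- s) sqn w,
    forall u, (forall w, w \in s -> ip u w = 0) -> ip u v' = ip u v &
  \sum_i psi i * gauss_mean M (nsq (ip v (z i))) (\sum_(w <- s) nsq (ip w (z i)))
    <= \sum_i psi i * gauss_mean M (nsq (ip v' (z i))) 0].
Proof.
elim: s v => [|w s IH] v /=.
  move=> _ _; exists v; split => //; first by rewrite big_nil addr0.
  by under eq_bigr do rewrite big_nil.
move=> /andP[/allP ws os] vs.
have [w' [w'E hw]] := sign_choice v w (fun i => \sum_(w <- s) nsq (ip w (z i))).
have ipw' u : ip u w = 0 -> ip u w' = 0.
  by case: w'E => -> // uw; rewrite ipNr uw oppr0.
have [||v' [nv' ov' hv']] := IH (v + w').
- exact: os.
- move=> u us; rewrite ipDl vs ?inE ?us ?orbT// add0r.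
  by case: w'E => ->; rewrite ?ipNl (eqP (ws _ us)) ?oppr0.
exists v'; split.
- rewrite nv' big_cons sqnD_orth; last by apply: ipw'; apply: vs; rewrite mem_head.
  by rewrite addrA; case: w'E => ->; rewrite // -scaleN1r sqnZ nsqN nsq1 mul1r.
- move=> u us; rewrite ov'; last by move=> w0 w0s; apply: us; rewrite inE w0s orbT.
  by rewrite ipDr (ipw' u) ?addr0//; apply: us; rewrite mem_head.
- under eq_bigr do rewrite big_cons.
  exact: le_trans hw hv'.
Qed.

End Signs.

Section Deterministic.
Variables (R : realType) (K : base_field).
Local Notation F := (fieldF R K).

Lemma ip_delta n (y : 'cV[F]_n) k : ip y (delta_mx k 0) = conjF (y k 0).
Proof.
rewrite ipE (bigD1 k)//= mxE !eqxx mulr1 big1 ?addr0// => j jk.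
by rewrite mxE (negPf jk) mulr0.
Qed.

Lemma sqn_delta n k : sqn (delta_mx k 0 : 'cV[F]_n) = 1.
Proof.
by apply: (@embF_inj R K); rewrite -ip_self ip_delta mxE !eqxx !rmorph1.
Qed.

Lemma normalize n (v : 'cV[F]_n) : v != 0 ->
  exists2 u, sqn u = 1 & v = embF (Num.sqrt (sqn v)) *: u.
Proof.
move=> v0; have sv : sqn v != 0 by rewrite sqn_eq0E.
have sv' : 0 < Num.sqrt (sqn v) by rewrite sqrtr_gt0 lt0r sv sqn_ge0.
exists (embF (Num.sqrt (sqn v))^-1 *: v).
  by rewrite sqnZ nsq_emb exprVn sqr_sqrtr ?sqn_ge0// mulVf.
by rewrite scalerA -rmorphM mulfV ?gt_eqF// rmorph1 scale1r.
Qed.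

Lemma exists_orthogonal n (y : 'cV[F]_n) : (1 < n)%N ->
  exists2 u, sqn u = 1 & ip y u = 0.
Proof.
move=> n1; pose i0 : 'I_n := Ordinal (ltnW n1); pose i1 : 'I_n := Ordinal n1.
have [y0|y0] := eqVneq (y i0 0) 0.
  by exists (delta_mx i0 0); rewrite ?sqn_delta// ip_delta y0 rmorph0.
(* The first two coordinates of y, exchanged and twisted. *)
pose v := conjF (y i1 0) *: (delta_mx i0 0 : 'cV[F]_n) -
          conjF (y i0 0) *: (delta_mx i1 0 : 'cV[F]_n).
have yv : ip y v = 0.
  by rewrite ipDr ipNr !ipZr !ip_delta mulrC subrr.
have v0 : v != 0.
  apply: contra y0 => /eqP/matrixP/(_ i1 0); rewrite !mxE !eqxx /= mulr0 mulr1.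
  by rewrite add0r => /eqP; rewrite oppr_eq0 fmorph_eq0.
have [u nu vu] := normalize v0; exists u => //.
have := yv; rewrite vu ipZr => /eqP; rewrite mulf_eq0 embF_eq0 sqrtr_eq0.
by rewrite leNgt lt0r sqn_eq0E v0 sqn_ge0 => /eqP.
Qed.

Variables (n m : nat) (n_gt1 : (1 < n)%N) (z : 'I_m -> 'cV[F]_n).
Variables (A kap M : R).
Hypotheses (A_gt0 : 0 < A) (kap_gt0 : 0 < kap) (M_gt0 : 0 < M).
Hypothesis traceP : forall y u, orthonormal2 y u ->
  0 < \sum_i trace_test A kap M (nsq (ip y (z i))) (nsq (ip u (z i))).
Hypothesis signP : forall y u, orthonormal2 y u ->
  0 < \sum_i sign_test kap M (nsq (ip y (z i))) (nsq (ip u (z i))).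

(** The trace test without its truncations. *)
Lemma trace_test_le y u : orthonormal2 y u ->
  \sum_i cutoff A (nsq (ip y (z i))) * nsq (ip y (z i)) <
  kap * \sum_i cutoff A (nsq (ip y (z i))) * nsq (ip u (z i)).
Proof.
move=> /traceP h; rewrite -subr_gt0; apply: lt_le_trans h _.
rewrite mulr_sumr -sumrB; apply: ler_sum => i _.
rewrite /trace_test mulrBr (cutoff_min _ id)// lerD2r mulrCA.
by rewrite ler_wpM2l ?(ltW kap_gt0)// ler_wpM2l ?cutoff_ge0// ge_min lexx.
Qed.

Lemma not_all_orthogonal u : sqn u = 1 -> (forall i, nsq (ip u (z i)) = 0) -> False.
Proof.
move=> nu uz; have [y ny uy] := exists_orthogonal u n_gt1.
have on : orthonormal2 y u by split => //; rewrite -ip_conj uy rmorph0.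
have := trace_test_le on; rewrite [X in _ < kap * X]big1 => [|i _]; last first.
  by rewrite uz mulr0.
rewrite mulr0 ltNge sumr_ge0// => i _.
by rewrite mulr_ge0 ?nsq_ge0 ?cutoff_ge0.
Qed.

(** The trace tests, summed over the eigenvectors in s, force the trace of the
    form below kap * l; a signed sum of its scaled eigenvectors then contradicts
    the sign test. *)
Lemma no_balanced_form (l : R) (y : 'cV[F]_n) (s : seq (R * 'cV[F]_n)) :
  0 < l -> sqn y = 1 -> orthonormal_seq s ->
  (forall p, p \in s -> 0 < p.1 /\ ip y p.2 = 0) ->
  (forall i, \sum_(p <- s) p.1 * nsq (ip p.2 (z i)) = l * nsq (ip y (z i))) ->
  False.
Proof.
move=> l0 ny [ns os] ps bal.
have on p : p \in s -> orthonormal2 y p.2.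
  by move=> pin; split; rewrite ?(ns p)//; case: (ps p pin).
set S := \sum_i cutoff A (nsq (ip y (z i))) * nsq (ip y (z i)).
have S0 : 0 <= S.
  by apply: sumr_ge0 => i _; rewrite mulr_ge0 ?nsq_ge0 ?cutoff_ge0.
have lS : l * S = \sum_(p <- s) p.1 *
    \sum_i cutoff A (nsq (ip y (z i))) * nsq (ip p.2 (z i)).
  under [RHS]eq_bigr do rewrite mulr_sumr.
  rewrite exchange_big mulr_sumr; apply: eq_bigr => i _ /=.
  rewrite mulrCA -bal mulr_sumr; apply: eq_bigr => p _.
  by rewrite mulrCA.
have tr : \sum_(p <- s) p.1 < kap * l.
  have [s0|[p pin]] : s = [::] \/ exists p, p \in s.
  - by case: (s) => [|p s']; [left|right; exists p; rewrite mem_head].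
  - by rewrite s0 big_nil mulr_gt0.
  have : (\sum_(p <- s) p.1) * S < kap * l * S.
    rewrite -mulrA lS mulr_suml mulr_sumr big_seq [ltRHS]big_seq.
    apply: ltr_sum; last first.
      move=> q qs; rewrite mulrCA ltr_pM2l; last by case: (ps q qs).
      exact: trace_test_le (on q qs).
    by apply/hasP; exists p.
  by move=> h; rewrite ltNge; apply/negP => h'; move: h; rewrite ltNge ler_wpM2r.
set w := fun p : R * 'cV[F]_n => embF (Num.sqrt (p.1 / l)) *: p.2.
have w2 p : p \in s -> Num.sqrt (p.1 / l) ^+ 2 = p.1 / l.
  by move=> /ps[p0 _]; rewrite sqr_sqrtr// divr_ge0 ?ltW.
have [|||v [nv ov hv]] := @signed_sum R K n m z
  (fun i => cutoff M (nsq (ip y (z i)))) M _ M_gt0 (map w s) 0.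
- by move=> i; exact: cutoff_ge0.
- rewrite pairwise_map; apply: sub_pairwise os => p q /= /eqP pq.
  by rewrite /w ipZl ipZr pq !mulr0.
- by move=> u _; rewrite ip0l.
have yv : ip y v = 0.
  rewrite ov ?ip0r// => u /mapP[p pin ->].
  by rewrite /w ipZr; have [_ ->] := ps p pin; rewrite mulr0.
have nv' : sqn v <= kap.
  rewrite nv sqn0 add0r big_map big_seq (eq_bigr (fun p => p.1 / l)) => [|p pin].
    by rewrite -big_seq -mulr_suml ler_pdivrMr// ltW.
  by rewrite sqnZ nsq_emb w2// ns// mulr1.
(* v may vanish, and then any unit vector orthogonal to y will do. *)
have [u [nu yu vu]] : exists u, [/\ sqn u = 1, ip y u = 0 &
    forall i, nsq (ip v (z i)) <= kap * nsq (ip u (z i))].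
  have [v0|v0] := eqVneq v 0.
    have [u nu yu] := exists_orthogonal y n_gt1; exists u; split => // i.
    by rewrite v0 ip0l nsq0 mulr_ge0 ?nsq_ge0 ?(ltW kap_gt0).
  have [u nu vu] := normalize v0; exists u; split => // [|i].
    have := yv; rewrite vu ipZr => /eqP; rewrite mulf_eq0 embF_eq0 sqrtr_eq0.
    by rewrite leNgt lt0r sqn_eq0E v0 sqn_ge0 => /eqP.
  rewrite {1}vu ipZl nsqM nsq_conj nsq_emb sqr_sqrtr ?sqn_ge0//.
  by rewrite ler_wpM2r// nsq_ge0.
have := signP (And3 ny nu yu); apply/negP; rewrite -leNgt.
under eq_bigr do rewrite /sign_test mulrBr
  (cutoff_min _ (fun t => t - 3 * t ^+ 2 / (4 * M)))//.
rewrite sumrB subr_le0.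
have Y i : \sum_(w0 <- map w s) nsq (ip w0 (z i)) = nsq (ip y (z i)).
  rewrite big_map -[RHS](mulKf (lt0r_neq0 l0)) -bal mulr_sumr big_seq [RHS]big_seq.
  apply: eq_bigr => p pin; rewrite ipZl nsqM nsq_conj nsq_emb w2// mulrA.
  by rewrite (mulrC p.1).
apply: le_trans (le_trans hv _); last first.
  apply: ler_sum => i _; rewrite ler_wpM2l ?cutoff_ge0//.
  apply: le_trans (gauss_mean_le_min _ M_gt0) _.
  by rewrite le_min !ge_min vu lexx orbT.
rewrite le_eqVlt; apply/orP; left; apply/eqP; apply: eq_bigr => i _.
rewrite ip0l nsq0 Y /gauss_mean; congr (_ * _).
by rewrite expr0n mulr0 mul0r !add0r.
Qed.
End Deterministic.

(** * From balanced forms to uniqueness *)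

Section Uniqueness.
Variables (R : realType) (K : base_field).
Local Notation F := (fieldF R K).

(** Two orthogonal eigenvectors with negative eigenvalues span a plane that
    meets the orthogonal complement of x, where H is nonnegative. *)
Lemma one_negative_eigenvalue n (H : 'M[F]_n) (x p q : 'cV[F]_n) (lp lq : R) :
  (forall v, ip x v = 0 -> 0 <= reF (ip v (H *m v))) ->
  sqn p = 1 -> sqn q = 1 -> ip p q = 0 ->
  H *m p = embF lp *: p -> H *m q = embF lq *: q -> lp < 0 -> lq < 0 -> False.
Proof.
move=> Hx np nq pq Hp Hq lp0 lq0.
have [a [b [ab0 abx]]] : exists a b : F, 0 < nsq a + nsq b /\
    ip x (a *: p + b *: q) = 0.
  have [xp0|xp0] := eqVneq (ip x p) 0.
    by exists 1, 0; rewrite nsq1 nsq0 addr0 scale1r scale0r addr0.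
  exists (ip x q), (- ip x p); split.
    rewrite nsqN ltr_wpDl ?nsq_ge0// lt0r nsq_ge0 andbT.
    by apply: contra xp0 => /eqP/nsq_eq0 ->.
  by rewrite ipDr !ipZr; ring.
have := Hx _ abx; rewrite leNgt; move/negP; apply.
have -> : ip (a *: p + b *: q) (H *m (a *: p + b *: q)) =
    embF (lp * nsq a + lq * nsq b).
  rewrite mulmxDr -!scalemxAr Hp Hq ipDl !ipDr !ipZl !ipZr !ip_self np nq pq.
  rewrite -[ip q p]ip_conj pq rmorph0 rmorph1 rmorphD !rmorphM /= !nsqE.
  by ring.
rewrite reF_emb; have [a0|a0] := ltP 0 (nsq a).
  by rewrite ltr_wnDr ?nmulr_rlt0// mulr_le0_ge0 ?nsq_ge0// ltW.
have -> : nsq a = 0 by apply/eqP; rewrite eq_le a0 nsq_ge0.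
by rewrite mulr0 add0r nmulr_rlt0//; move: ab0 a0; lra.
Qed.

(** The difference of X and the rank-one matrix vanishes on the sample; its
    negative part has rank at most one, by positivity of X. *)
Lemma psd_recovery (n m : nat) (z : 'I_m -> 'cV[F]_n) (A kap M : R)
    (x : 'cV[F]_n) (X : 'M[F]_n) :
  (1 < n)%N -> 0 < A -> 0 < kap -> 0 < M ->
  (forall y u, orthonormal2 y u ->
    0 < \sum_i trace_test A kap M (nsq (ip y (z i))) (nsq (ip u (z i)))) ->
  (forall y u, orthonormal2 y u ->
    0 < \sum_i sign_test kap M (nsq (ip y (z i))) (nsq (ip u (z i)))) ->
  adjF X = X -> (forall v, 0 <= ip v (X *m v)) ->
  (forall i, ip (z i) (X *m z i) = embF (nsq (ip x (z i)))) ->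
  X = x *m adjF x.
Proof.
move=> n1 A0 kap0 M0 traceP signP Xh Xpsd Xz.
pose H := X - x *m adjF x.
have Hh : adjF H = H by rewrite /H -scaleN1r adjFD adjFZ rmorphN1 adjFM adjFK Xh.
have HE v : ip v (H *m v) = ip v (X *m v) - embF (nsq (ip x v)).
  rewrite mulmxBl ipDr ipNr rank1_mul ipZr; congr (_ - _).
  by rewrite nsqE ip_conj.
have Hx v : ip x v = 0 -> 0 <= reF (ip v (H *m v)).
  move=> xv; rewrite HE xv nsq0 rmorph0 subr0.
  have := Xpsd v; have re : conjF (ip v (X *m v)) = ip v (X *m v).
    by rewrite ip_conj ip_adj Xh.
  by rewrite (real_emb re) reF_emb -(rmorph0 (@embF R K)) embF_le.
have Hz i : ip (z i) (H *m z i) = 0 by rewrite HE Xz subrr.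
have [s [os s0 Hs]] := spectral_decomposition Hh.
have qs i : \sum_(q <- s) q.1 * nsq (ip q.2 (z i)) = 0.
  by apply: (@embF_inj R K); rewrite -quadratic_form_rank1 -Hs Hz rmorph0.
have eig p : p \in s -> H *m p.2 = embF p.1 *: p.2.
  by rewrite {1}Hs; exact: sum_rank1_eigen.
have [ns prw] := os.
suff snil : s = [::].
  by apply/eqP; rewrite -subr_eq0 -/H Hs snil big_nil.
pose neg := fun p : R * 'cV[F]_n => p.1 < 0.
have fneg p : p \in s -> ~~ neg p -> 0 < p.1.
  by move=> ps; rewrite /neg -leNgt lt0r (s0 p ps).
case nE : (seq.filter neg s) => [|p [|q ?]].
- have pos p : p \in s -> 0 < p.1.
    move=> ps; apply: fneg => //; apply/negP => np.
    by have : p \in seq.filter neg s; [rewrite mem_filter np ps | rewrite nE].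
  case sE : s => [//|p s'].
  have ps : p \in s by rewrite sE mem_head.
  exfalso; apply: (not_all_orthogonal n1 A0 kap0 traceP (ns p ps)) => i.
  have : all (fun q => q.1 * nsq (ip q.2 (z i)) == 0) s.
    have /eqP := qs i; rewrite big_seq psumr_eq0 => [/allP h|q qin].
      by apply/allP => q qin; apply: implyP (h q qin) _.
    by rewrite mulr_ge0 ?nsq_ge0 ?ltW ?pos.
  move=> /allP/(_ p ps); rewrite mulf_eq0 (gt_eqF (pos p ps)) => /eqP //.
- have pneg : p \in seq.filter neg s by rewrite nE mem_head.
  move: pneg; rewrite mem_filter => /andP[pn ps].
  pose s' := [seq q <- s | ~~ neg q].
  exfalso.
  apply: (@no_balanced_form R K n m n1 z A kap M A0 kap0 M0 traceP signP
    (- p.1) p.2 s').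
  + by rewrite oppr_gt0.
  + exact: ns.
  + split; first by move=> q; rewrite mem_filter => /andP[_ /ns].
    exact: pairwise_filter.
  + move=> q; rewrite mem_filter => /andP[qn qs']; split; first exact: fneg.
    have [pq|pq] := eqVneq p q; first by rewrite -pq pn in qn.
    have e : embF p.1 * ip p.2 q.2 = embF q.1 * ip p.2 q.2.
      rewrite -[RHS]ipZr -eig// ip_adj Hh eig// ipZl conjF_emb //.
    have : (embF p.1 - embF q.1) * ip p.2 q.2 = 0 by rewrite mulrBl e subrr.
    move/eqP; rewrite mulf_eq0 subr_eq0 (inj_eq (@embF_inj R K)) => /orP[|/eqP//].
    by move=> /eqP pqe; move: qn; rewrite /neg -pqe -/(neg p) pn.
  + move=> i; have := qs i; rewrite (bigID neg)/= -big_filter nE big_seq1 -big_filter => /eqP.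
    by rewrite addrC addr_eq0 mulNr => /eqP.
- exfalso.
  have : pairwise (fun p q : R * 'cV[F]_n => ip p.2 q.2 == 0) (seq.filter neg s).
    exact: pairwise_filter.
  rewrite nE /= => /andP[/andP[/eqP pq _] _].
  have : p \in seq.filter neg s by rewrite nE mem_head.
  have : q \in seq.filter neg s by rewrite nE !inE eqxx orbT.
  rewrite !mem_filter => /andP[qn qin] /andP[pn pin].
  exact: (one_negative_eigenvalue Hx (ns p pin) (ns q qin) pq (eig p pin) (eig q qin)).
Qed.
End Uniqueness.

(** * Borel measurability *)

Section Measurability.
Variables (R : realType) (K : base_field) (n : nat).
Local Notation F := (fieldF R K).
Local Notation V := (vecF R K n).

Lemma reF_continuous : continuous (@reF R K).
Proof.
case: K => /= a; first exact: cvg_id.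
move=> A /nbhs_ballP[e e0 eA]; apply/nbhs_ballP; exists (real_complex R e).
  by rewrite /= ltcR.
move=> b; rewrite /ball /= => ab; apply: eA; rewrite /ball /=.
have : (real_complex R `|complex.Re (a - b)|) < real_complex R e.
  by apply: le_lt_trans ab; exact: normc_ge_Re.
by rewrite ltcR raddfB.
Qed.

Lemma nsq_reE (a : F) : nsq a = reF (`|a| * `|a|).
Proof. by rewrite -expr2 -nsq_norm reF_emb. Qed.

Lemma ip_continuous (y : 'cV[F]_n) : continuous (fun z : 'cV[F]_n => ip y z).
Proof.
have -> : (fun z : 'cV[F]_n => ip y z) =
    (fun z => \sum_(k <- index_enum 'I_n | true) conjF (y k 0) * z k 0).
  by apply/funext => ?; rewrite ipE.
apply: continuous_big => [|k _ z]; first exact: add_continuous.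
apply: cvgMl_tmp; first exact: (nbhs_filter z).
exact: (@coord_continuous F n 1 k 0 z).
Qed.

Lemma nsq_continuous : continuous (@nsq R K).
Proof.
have -> : @nsq R K = (@reF R K \o (fun a => `|a| * `|a|)).
  by apply/funext => ?; rewrite /= nsq_reE.
move=> a; apply: continuous_comp; last exact: reF_continuous.
have nc : {for a, continuous (fun b : F => `|b|)} by exact: norm_continuous.
by have := cvgM nc nc; exact.
Qed.

Lemma mulmx_continuous (U : 'M[F]_n) : continuous (fun z : 'cV[F]_n => U *m z).
Proof.
move=> z A [P hP PA]; rewrite nbhs_filterE.
have : \near z, forall ij : 'I_n * 'I_1, P ij.1 ij.2 ((U *m z) ij.1 ij.2).
  apply: (@filter_forall _ _
    (fun (ij : 'I_n * 'I_1) v => P ij.1 ij.2 ((U *m v) ij.1 ij.2))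
    (nbhs z) (nbhs_filter z)) => -[i j] /=.
  have e v : (U *m v) i j = ip (adjF (row i U)) v.
    by rewrite /ip adjFK -row_mul [RHS]mxE (ord1 j).
  have /(ip_continuous) : nbhs (ip (adjF (row i U)) z) (P i j) by rewrite -e.
  by apply: (@filterS _ (nbhs z) (nbhs_filter z)) => v; rewrite /preimage /= e.
apply: (@filterS _ (nbhs z) (nbhs_filter z)) => v h; apply: PA => i j; exact: (h (i, j)).
Qed.

Lemma continuous_measurable (f : 'cV[F]_n -> R) :
  continuous f -> measurable_fun setT (f : V -> R).
Proof.
move=> fc; apply: (measurability _ (RGenOpens.measurableE R)).
move=> _ [_ [a [b ->] <-]]; rewrite setTI; apply: sub_sigma_algebra.
by apply: open_comp => [? _|]; [exact: fc|exact: interval_open].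
Qed.

(** Needed for the invariance of the measure to pass to integrals. *)
Lemma mulmx_measurable (U : 'M[F]_n) :
  measurable_fun setT (fun z : V => U *m z : V).
Proof.
apply: (@measurability _ _ V V setT _ [set A : set 'cV[F]_n | open A] erefl).
move=> _ [A Aopen <-]; rewrite setTI; apply: sub_sigma_algebra.
by apply: open_comp => // ? _; exact: mulmx_continuous.
Qed.

Lemma ip_measurable (y : 'cV[F]_n) :
  measurable_fun setT (fun z : V => nsq (ip y z)).
Proof.
apply: (@continuous_measurable (@nsq R K \o ip y)) => z.
by apply: continuous_comp; [exact: ip_continuous|exact: nsq_continuous].
Qed.

Lemma unit_sphereE : @unit_sphere R K n = [set u | sqn u = 1].
Proof.
apply/seteqP; split => u /=.
  move=> h; apply: (@embF_inj R K); rewrite rmorph1; refine (etrans _ h).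
  rewrite rmorph_sum; apply: eq_bigr => i _; exact: nsq_norm.
move=> /(congr1 (@embF R K)); rewrite rmorph1 => h; refine (etrans _ h).
rewrite rmorph_sum; apply: eq_bigr => i _; exact: (esym (nsq_norm _)).
Qed.

Lemma sqn_ip_delta (u : 'cV[F]_n) : sqn u = \sum_k nsq (ip (delta_mx k 0) u).
Proof. by apply: eq_bigr => k _; rewrite -ip_conj nsq_conj ip_delta nsq_conj. Qed.

Lemma unit_sphere_measurable : measurable (@unit_sphere R K n : set V).
Proof.
rewrite unit_sphereE.
have m : measurable_fun setT (fun u : V => sqn (u : 'cV[F]_n)).
  have -> : (fun u : V => sqn (u : 'cV[F]_n)) =
      (fun u : V => \sum_k nsq (ip (delta_mx k 0) u)).
    by apply/funext => u; exact: sqn_ip_delta.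
  by apply: measurable_sum => k; exact: ip_measurable.
rewrite -[X in measurable X]setTI.
have -> : [set u : V | sqn (u : 'cV[F]_n) = 1] =
    (fun u : V => sqn (u : 'cV[F]_n)) @^-1` [set 1].
  by [].
by apply: m => //; exact: measurable_set1.
Qed.

End Measurability.

(** * Means over the sphere *)

Section Expectation.
Variables (R : realType) (K : base_field) (n : nat).
Local Notation F := (fieldF R K).
Local Notation V := (vecF R K n).
Local Notation S := (@unit_sphere R K n : set V).
Variable mu : probability V R.
Hypothesis mu_unif : uniform_on_sphere mu.

(** Boundedness is required on the sphere only: squared coordinates are unbounded
    on the whole space. *)
Definition bmeas (f : V -> R) :=
  measurable_fun setT f /\ exists B, forall z : V, sqn (z : 'cV[F]_n) = 1 -> `|f z| <= B.

Definition sphere_mean (f : V -> R) : R := \int[mu]_(z in S) f z.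

Local Notation Ex := sphere_mean.

Definition sq (y : 'cV[F]_n) (z : V) : R := n%:R * nsq (ip y z).

Lemma sphereP (z : V) : S z <-> sqn (z : 'cV[F]_n) = 1.
Proof. by rewrite unit_sphereE. Qed.

Lemma sq_ge0 y z : 0 <= sq y z.
Proof. by rewrite mulr_ge0 ?nsq_ge0. Qed.

Lemma bmeas_cst r : bmeas (fun=> r).
Proof. by split; [exact: measurable_cst|exists `|r|]. Qed.

Lemma bmeas_sq y : bmeas (sq y).
Proof.
split; first by apply: measurable_funM => //; exact: ip_measurable.
exists (n%:R * sqn y) => z z1; rewrite ger0_norm ?sq_ge0//.
by rewrite ler_wpM2l// -[leRHS]mulr1 -z1 cauchy_schwarz.
Qed.

Lemma bmeasD f g : bmeas f -> bmeas g -> bmeas (fun z => f z + g z).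
Proof.
move=> [mf [B fB]] [mg [C gC]]; split; first exact: measurable_funD.
exists (B + C) => z z1; apply: le_trans (ler_normD _ _) _.
by rewrite lerD ?fB ?gC.
Qed.

Lemma bmeasN f : bmeas f -> bmeas (fun z => - f z).
Proof.
move=> [mf [B fB]]; split; first exact: measurable_funN.
by exists B => z z1; rewrite normrN fB.
Qed.

Lemma bmeasM f g : bmeas f -> bmeas g -> bmeas (fun z => f z * g z).
Proof.
move=> [mf [B fB]] [mg [C gC]]; split; first exact: measurable_funM.
by exists (B * C) => z z1; rewrite normrM ler_pM ?fB ?gC.
Qed.

Lemma bmeasX f k : bmeas f -> bmeas (fun z => f z ^+ k).
Proof.
move=> [mf [B fB]]; split; first exact: measurable_funX.
by exists (B ^+ k) => z z1; rewrite normrX lerXn2r ?nnegrE ?(le_trans _ (fB z z1))// fB.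
Qed.

Lemma bmeas_max f g : bmeas f -> bmeas g -> bmeas (fun z => Num.max (f z) (g z)).
Proof.
move=> [mf [B fB]] [mg [C gC]]; split; first exact: measurable_maxr.
exists (Num.max B C) => z z1; rewrite le_max.
by have [_|_] := leP (f z) (g z); rewrite ?fB ?gC ?orbT.
Qed.

Lemma bmeas_min f g : bmeas f -> bmeas g -> bmeas (fun z => Num.min (f z) (g z)).
Proof.
move=> [mf [B fB]] [mg [C gC]]; split; first exact: measurable_minr.
exists (Num.max B C) => z z1; rewrite le_max.
by have [_|_] := leP (f z) (g z); rewrite ?fB ?gC ?orbT.
Qed.

Lemma bmeas_sum (I : Type) (r : seq I) (f : I -> V -> R) :
  (forall i, bmeas (f i)) -> bmeas (fun z => \sum_(i <- r) f i z).
Proof.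
move=> fb; elim: r => [|i r IH].
  by under eq_fun do rewrite big_nil; exact: bmeas_cst.
by under eq_fun do rewrite big_cons; apply: bmeasD.
Qed.

Lemma bmeas_cutoff (A : R) (f : V -> R) : bmeas f -> bmeas (fun z => cutoff A (f z)).
Proof.
move=> bf; apply: bmeas_max (bmeas_cst _) _.
by apply: bmeasD (bmeas_cst _) _; apply: bmeasN; apply: bmeasM bf (bmeas_cst _).
Qed.

Lemma muS : mu S = 1%E.
Proof. by case: mu_unif. Qed.

Lemma Ex_integrable f : bmeas f -> mu.-integrable S (EFin \o f).
Proof.
move=> [mf [B fB]]; apply: measurable_bounded_integrable.
- exact: unit_sphere_measurable.
- by apply: le_lt_trans (ltry 1); rewrite [leLHS]muS.
- exact: measurable_funTS.
- exists B; split => [|M BM z /sphereP z1]; first exact: num_real.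
  exact: le_trans (fB z z1) (ltW BM).
Qed.

Lemma ExD f g : bmeas f -> bmeas g -> Ex (fun z => f z + g z) = Ex f + Ex g.
Proof.
by move=> bf bg; apply: RintegralD; [exact: unit_sphere_measurable|exact: Ex_integrable..].
Qed.

Lemma ExZ r f : bmeas f -> Ex (fun z => r * f z) = r * Ex f.
Proof.
by move=> bf; apply: RintegralZl; [exact: unit_sphere_measurable|exact: Ex_integrable].
Qed.

Lemma ExN f : bmeas f -> Ex (fun z => - f z) = - Ex f.
Proof.
move=> bf; rewrite -mulN1r -ExZ//; congr Ex; apply/funext => z.
by rewrite mulN1r.
Qed.

Lemma ExB f g : bmeas f -> bmeas g -> Ex (fun z => f z - g z) = Ex f - Ex g.
Proof. by move=> bf bg; rewrite ExD ?ExN//; exact: bmeasN. Qed.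

Lemma Ex_cst r : Ex (fun=> r) = r.
Proof.
rewrite /sphere_mean Rintegral_cst; last exact: unit_sphere_measurable.
rewrite -[RHS]mulr1; congr (_ * _).
exact: (congr1 fine muS).
Qed.

Lemma Ex_le f g : bmeas f -> bmeas g ->
  (forall z, sqn (z : 'cV[F]_n) = 1 -> f z <= g z) -> Ex f <= Ex g.
Proof.
move=> bf bg fg; apply: le_Rintegral; [exact: unit_sphere_measurable|exact: Ex_integrable..|].
by move=> z /sphereP; exact: fg.
Qed.

Lemma Ex_eq f g : (forall z, sqn (z : 'cV[F]_n) = 1 -> f z = g z) -> Ex f = Ex g.
Proof.
by move=> fg; apply: eq_Rintegral => z /set_mem /sphereP; exact: fg.
Qed.

Lemma Ex_sum (I : Type) (r : seq I) (f : I -> V -> R) : (forall i, bmeas (f i)) ->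
  Ex (fun z => \sum_(i <- r) f i z) = \sum_(i <- r) Ex (f i).
Proof.
move=> fb; elim: r => [|i r IH].
  by rewrite big_nil -[RHS](Ex_cst 0); congr Ex; apply/funext => z; rewrite big_nil.
rewrite big_cons -IH -ExD//; last exact: bmeas_sum.
by congr Ex; apply/funext => z; rewrite big_cons.
Qed.

Lemma Ex_unitary (U : 'M[F]_n) f : U *m adjF U = 1%:M -> bmeas f ->
  Ex (fun z => f (U *m z)) = Ex f.
Proof.
move=> UU bf; rewrite /sphere_mean /Rintegral; congr fine.
pose phi := fun z : V => (U *m z : V).
have phiS : phi @^-1` S = S.
  by apply/seteqP; split => z /=; rewrite !sphereP /phi sqn_unitary.
have bfU : bmeas (f \o phi).
  case: bf => mf [B fB]; split; first exact: measurableT_comp (mulmx_measurable U).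
  by exists B => z z1; apply: fB; rewrite /phi sqn_unitary.
have mfE : measurable_fun setT (EFin \o f) by apply/measurable_EFinP; case: bf.
have intS : mu.-integrable (phi @^-1` S) ((EFin \o f) \o phi).
  by rewrite phiS; exact: Ex_integrable bfU.
have := integral_pushforward (mulmx_measurable U) mfE intS
  (@unit_sphere_measurable R K n).
rewrite phiS => /esym ->.
apply: eq_measure_integral => [|mU A mA _]; first exact: mulmx_measurable.
by case: mu_unif => _ /(_ U A UU mA).
Qed.

End Expectation.

(* Only syntactic matching, so that no function is unfolded in the search. *)
Ltac bmeas_tac := repeat lazymatch goal with
  | |- bmeas (sq _) => exact: bmeas_sq
  | |- bmeas (fun z => sq ?y z) => exact: (bmeas_sq y)
  | |- bmeas (fun _ => ?r) => apply: bmeas_cst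
  | |- bmeas (fun z => @?f z + @?g z) => apply: (@bmeasD _ _ _ f g)
  | |- bmeas (fun z => - @?f z) => apply: (@bmeasN _ _ _ f)
  | |- bmeas (fun z => @?f z * @?g z) => apply: (@bmeasM _ _ _ f g)
  | |- bmeas (fun z => @?f z ^+ ?k) => apply: (@bmeasX _ _ _ f k)
  | |- bmeas (fun z => Num.max (@?f z) (@?g z)) => apply: (@bmeas_max _ _ _ f g)
  | |- bmeas (fun z => Num.min (@?f z) (@?g z)) => apply: (@bmeas_min _ _ _ f g)
  | |- bmeas (fun z => cutoff ?A (@?f z)) => apply: (@bmeas_cutoff _ _ _ A f)
  | |- bmeas _ => first [assumption | apply: bmeas_sum => ? ]
  end.

(** * Moments of squared coordinates *)

Section Moments.
Variables (R : realType) (K : base_field) (n : nat).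
Local Notation F := (fieldF R K).
Local Notation V := (vecF R K n).
Variable mu : probability V R.
Hypothesis mu_unif : uniform_on_sphere mu.
Local Notation Ex := (sphere_mean mu).

(** Unit vectors can be made to have a real inner product by a change of phase. *)
Lemma phase (a : F) : exists2 th : F, nsq th = 1 & conjF (th * a) = th * a.
Proof.
have [a0|a0] := eqVneq (nsq a) 0.
  by exists 1; rewrite ?nsq1// (nsq_eq0 a0) mulr0 rmorph0.
exists (embF (Num.sqrt (nsq a))^-1 * conjF a).
  by rewrite nsqM nsq_conj nsq_emb exprVn sqr_sqrtr ?nsq_ge0// mulVf.
by rewrite !rmorphM /= conjFK conjF_emb -!mulrA (mulrC a).
Qed.

Lemma sqZ (a : F) (y : 'cV[F]_n) (z : V) : nsq a = 1 -> sq (a *: y) z = sq y z.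
Proof. by move=> a1; rewrite /sq ipZl nsqM nsq_conj a1 mul1r. Qed.

Lemma Ex_unit (y y' : 'cV[F]_n) (f : R -> R) : sqn y = 1 -> sqn y' = 1 ->
  bmeas (fun z : V => f (sq y z)) ->
  Ex (fun z => f (sq y' z)) = Ex (fun z => f (sq y z)).
Proof.
move=> ny ny' bf; have [th nth re] := phase (ip y y').
have nt : sqn (th *: y') = 1 by rewrite sqnZ nth ny' mulr1.
have [|U [UU UH Uy _]] := reflection ny nt.
  by rewrite -[RHS]ip_conj ipZr re.
rewrite -(Ex_unitary mu_unif UU bf); apply: Ex_eq => z _.
by rewrite /sq ip_adj UH Uy -/(sq _ z) -/(sq _ z) sqZ.
Qed.

Lemma Ex_swap (y u : 'cV[F]_n) (f : R -> R -> R) : orthonormal2 y u ->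
  bmeas (fun z : V => f (sq y z) (sq u z)) ->
  Ex (fun z => f (sq u z) (sq y z)) = Ex (fun z => f (sq y z) (sq u z)).
Proof.
move=> [ny nu yu] bf; have [|U [UU UH Uy Uu]] := reflection ny nu.
  by rewrite -[RHS]ip_conj yu rmorph0.
rewrite -(Ex_unitary mu_unif UU bf); apply: Ex_eq => z _.
by rewrite /sq !ip_adj UH Uy Uu.
Qed.

(** Rotating the plane of y and u by an eighth of a turn, after a change of
    phase, turns the difference of the squared coordinates into a polarization
    term.  The rotated vectors p and q are the images of y and u by the
    reflection that exchanges y and p. *)
Lemma Ex_rotation (y u : 'cV[F]_n) (om : F) : orthonormal2 y u -> nsq om = 1 ->
  exists p q : 'cV[F]_n,
  [/\ forall f : R -> R -> R, bmeas (fun z : V => f (sq y z) (sq u z)) ->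
        Ex (fun z => f (sq p z) (sq q z)) = Ex (fun z => f (sq y z) (sq u z)),
      forall z, sq p z + sq q z = sq y z + sq u z &
      forall z, sq p z - sq q z =
        n%:R * (2 * reF (ip y z * conjF (om * ip u z)))].
Proof.
move=> [ny nu yu] nom.
pose h := Num.sqrt (2^-1 : R); pose w := conjF om *: u.
have h2 : h ^+ 2 = 2^-1 by rewrite sqr_sqrtr// invr_ge0.
have nw : sqn w = 1 by rewrite sqnZ nsq_conj nom nu mulr1.
have yw : ip y w = 0 by rewrite ipZr yu mulr0.
pose p := embF h *: (y + w); pose q := embF h *: (y - w).
have np : sqn p = 1.
  by rewrite sqnZ nsq_emb h2 sqnD_orth// ny nw; field.
have h2h : 2 * h * h = 1 by rewrite -mulrA -expr2 h2 mulfV.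
have [|U [UU UH Uy Up]] := reflection ny np.
  by rewrite ipZr ipZl ipDr ipDl yw -[ip w y]ip_conj yw rmorph0 addr0 conjF_emb.
have Uw : U *m w = q.
  have wE : w = embF (2 * h) *: p - y.
    by rewrite /p scalerA -rmorphM h2h rmorph1 scale1r addrAC subrr add0r.
  rewrite wE mulmxBr -scalemxAr Up Uy /p /q.
  rewrite mulr_natl mulr2n rmorphD scalerDl scalerDr scalerBr.
  by rewrite opprD addrA addrK.
exists p, q; split.
- move=> f bf; rewrite -(Ex_unitary mu_unif UU bf); apply: Ex_eq => z _.
  rewrite /sq !ip_adj UH Uy -Uw.
  by rewrite /w -scalemxAr -!/(sq _ z) (sqZ (a := conjF om)) ?nsq_conj.
- move=> z; rewrite /sq -!mulrDr; congr (_ * _).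
  rewrite /p /q !ipZl !nsqM !nsq_conj !nsq_emb !ipDl ipNl nsqD nsqB h2.
  rewrite /w ipZl conjFK nsqM nom.
  by field.
- move=> z; rewrite /sq -!mulrBr; congr (_ * _).
  rewrite /p /q !ipZl !nsqM !nsq_conj !nsq_emb !ipDl ipNl nsqD nsqB h2.
  rewrite /w ipZl conjFK.
  by field.
Qed.

Lemma sum_sq_delta (z : V) : sqn (z : 'cV[F]_n) = 1 ->
  \sum_k sq (delta_mx k 0) z = n%:R.
Proof. by move=> z1; rewrite -mulr_sumr -sqn_ip_delta z1 mulr1. Qed.

(** The n squared coordinates have equal means and sum to n on the sphere. *)
Lemma Ex_sq (y : 'cV[F]_n) : (0 < n)%N -> sqn y = 1 -> Ex (sq y) = 1.
Proof.
move=> n0 ny.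
have e : \sum_(k < n) Ex (sq (delta_mx k 0)) = n%:R.
  rewrite -(Ex_sum mu_unif); last by move=> k; exact: bmeas_sq.
  by rewrite -[RHS](Ex_cst mu_unif); apply: Ex_eq => z; exact: sum_sq_delta.
move: e; rewrite (eq_bigr (fun=> Ex (sq y))) => [|k _].
  rewrite sumr_const card_ord -[LHS]mulr_natl => e.
  have n0' : n%:R != 0 :> R by rewrite pnatr_eq0 -lt0n.
  by apply: (mulfI n0'); rewrite mulr1.
by apply: (Ex_unit (f := id) ny) => //; [exact: sqn_delta|bmeas_tac].
Qed.

(** Averaging s^2 over the rotations by plus and minus an eighth of a turn gives
    (s + t)^2 / 4 plus the square of a polarization term, which is at most s t. *)
Lemma Ex_sq2_le_mixed (y u : 'cV[F]_n) : orthonormal2 y u ->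
  Ex (fun z => sq y z ^+ 2) <= 3 * Ex (fun z => sq y z * sq u z).
Proof.
move=> on; have [ny nu yu] := on.
have [p [q [Epq Dpq Bpq]]] := Ex_rotation on (nsq1 R K).
have b : bmeas (fun z : V => sq y z ^+ 2) by bmeas_tac.
have e1 : Ex (fun z => sq p z ^+ 2) = Ex (fun z => sq y z ^+ 2).
  exact: (Epq (fun s t => s ^+ 2)).
have e3 : Ex (fun z => sq u z ^+ 2) = Ex (fun z => sq y z ^+ 2).
  exact: (Ex_swap (f := fun s t => s ^+ 2) on).
have e2 : Ex (fun z => sq q z ^+ 2) = Ex (fun z => sq y z ^+ 2).
  by rewrite -e3; apply: (Epq (fun s t => t ^+ 2)); bmeas_tac.
have : Ex (fun z => sq p z ^+ 2 + sq q z ^+ 2) <=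
    Ex (fun z => 2^-1 * (sq y z ^+ 2 + sq u z ^+ 2) + 3 * (sq y z * sq u z)).
  apply: Ex_le => //; [by bmeas_tac..|] => z _.
  have c2 : (sq p z - sq q z) ^+ 2 <= 4 * (sq y z * sq u z).
    rewrite Bpq mul1r; have := re_sq_le (ip y z) (ip u z).
    rewrite /sq; move: (reF _) (nsq _) (nsq _) (n%:R : R) => r s t N h.
    have := ler_wpM2l (sqr_ge0 N) h; lra.
  by move: c2 (Dpq z); move: (sq p z) (sq q z) (sq y z) (sq u z) => P Q s t; nra.
rewrite (ExD mu_unif) ?(ExD mu_unif) ?(ExZ mu_unif) ?(ExD mu_unif) ?e1 ?e2 ?e3; bmeas_tac.
by lra.
Qed.

(** Multiplying the sum of the coordinates by one of them expresses n as a second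
    moment plus n - 1 mixed moments, each at least a third of the former. *)
Lemma Ex_sq2 (y : 'cV[F]_n) : (0 < n)%N -> sqn y = 1 ->
  Ex (fun z => sq y z ^+ 2) <= 3.
Proof.
move=> n0 ny; pose k0 : 'I_n := Ordinal n0; pose e k : 'cV[F]_n := delta_mx k 0.
have ne k : sqn (e k) = 1 by exact: sqn_delta.
have b : bmeas (fun z : V => sq y z ^+ 2) by bmeas_tac.
have bk : bmeas (fun z : V => sq (e k0) z ^+ 2) by bmeas_tac.
rewrite -(Ex_unit (f := fun s => s ^+ 2) ny (ne k0) b).
set a := Ex _.
have h : n%:R = \sum_(k < n) Ex (fun z => sq (e k0) z * sq (e k) z).
  rewrite -(Ex_sum mu_unif); last by move=> k; bmeas_tac.
  rewrite -[LHS]mulr1 -[X in _ * X](Ex_sq n0 (ne k0)) -(ExZ mu_unif); last by bmeas_tac.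
  by apply: Ex_eq => z z1; rewrite -mulr_sumr sum_sq_delta// mulrC.
have a0 : 0 <= a.
  by rewrite -(Ex_cst mu_unif 0); apply: (Ex_le mu_unif) => [||z _];
    [by bmeas_tac|by bmeas_tac|exact: sqr_ge0].
have : n%:R * a <= 3 * n%:R.
  rewrite [in leRHS]h mulr_sumr mulr_natl -[X in a *+ X]card_ord -sumr_const.
  apply: ler_sum => k _; have [->|kk] := eqVneq k k0.
    rewrite (_ : Ex _ = a); first by rewrite ler_peMl// ler1n.
    by congr Ex; apply/funext => z; rewrite expr2.
  apply: Ex_sq2_le_mixed; split => //.
  by rewrite ip_delta mxE (negPf kk) rmorph0.
by rewrite mulrC ler_pM2r// ltr0n.
Qed.

End Moments.

(** * Means of the test functions *)

Section TestMeans.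
Variables (R : realType) (K : base_field) (n : nat).
Local Notation F := (fieldF R K).
Local Notation V := (vecF R K n).
Variable mu : probability V R.
Hypotheses (mu_unif : uniform_on_sphere mu) (n_gt0 : (0 < n)%N).
Local Notation Ex := (sphere_mean mu).

(* Linear arithmetic in which the expectations are opaque atoms. *)
Ltac Ex_lra := repeat match goal with
  | |- context [@sphere_mean ?R ?K ?n ?mu ?f] => generalize (@sphere_mean R K n mu f) => ?
  end; clear -mu_unif n_gt0; lra.

Lemma cutoff_le1 (A s : R) : 0 < A -> 0 <= s -> cutoff A s <= 1.
Proof. by move=> A0 s0; rewrite /cutoff ge_max ler01 gerBl divr_ge0// ltW. Qed.

Lemma cutoff_ge (A s : R) : 1 - s / A <= cutoff A s.
Proof. by rewrite /cutoff le_max lexx orbT. Qed.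

(** When s + t <= A, both cutoffs are on their affine part. *)
Lemma cutoff_slope (A s t : R) : 0 < A -> 0 <= s -> 0 <= t ->
  (t - s) ^+ 2 * cutoff A (s + t) / A <= (cutoff A s - cutoff A t) * (t - s).
Proof.
move=> A0 s0 t0; have [wA|Aw] := leP (s + t) A.
  have le1 r : r <= A -> cutoff A r = 1 - r / A.
    by move=> rA; apply/max_idPr; rewrite subr_ge0 ler_pdivrMr// mul1r.
  have -> : (cutoff A s - cutoff A t) * (t - s) = (t - s) ^+ 2 / A.
    by rewrite !le1; [field; rewrite gt_eqF|lra..].
  rewrite ler_pM2r ?invr_gt0// ler_piMr ?sqr_ge0// cutoff_le1// addr_ge0//.
rewrite cutoff_eq0 ?(ltW Aw)// mulr0 mul0r.
have mono (r r' : R) : r <= r' -> cutoff A r' <= cutoff A r.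
  move=> rr'; rewrite /cutoff ge_max !le_max lexx /= lerD2l lerN2.
  by rewrite ler_pM2r ?invr_gt0// rr' orbT.
have [st|ts] := leP s t.
  by rewrite mulr_ge0// subr_ge0// mono.
by rewrite mulr_le0// subr_le0 ?mono// ltW.
Qed.

(** A truncated quadratic lower bound; the truncation costs a multiple of the
    second moment only. *)
Lemma sqr_cutoff_ge (A w : R) : 0 < A -> 0 <= w ->
  2 * w - 1 - 2 / A * w ^+ 2 <= w ^+ 2 * cutoff A w.
Proof.
move=> A0 w0; have [wA|Aw] := leP w A; last first.
  rewrite cutoff_eq0 ?(ltW Aw)// mulr0 mulrAC.
  have : 2 * w <= 2 * w ^+ 2 / A.
    by rewrite ler_pdivlMr// expr2 mulrA ler_pM2l ?mulr_gt0 ?ltW// (lt_trans A0).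
  lra.
have h : w ^+ 2 * (1 - w / A) <= w ^+ 2 * cutoff A w.
  by rewrite ler_wpM2l ?sqr_ge0// cutoff_ge.
apply: le_trans h; rewrite -subr_ge0.
have -> : w ^+ 2 * (1 - w / A) - (2 * w - 1 - 2 / A * w ^+ 2) =
  (w - 1) ^+ 2 + w ^+ 2 * (2 - w) / A by field; rewrite gt_eqF.
have [w2|w2] := leP w 2.
  rewrite addr_ge0 ?sqr_ge0// divr_ge0 ?(ltW A0)// mulr_ge0 ?sqr_ge0//.
  by rewrite subr_ge0.
have : w ^+ 2 * (w - 2) / A <= w * (w - 2).
  rewrite ler_pdivrMr// expr2 -!mulrA ler_wpM2l// mulrC ler_wpM2l//.
  by rewrite subr_ge0 ltW.
have -> : w ^+ 2 * (2 - w) / A = - (w ^+ 2 * (w - 2) / A) by field; rewrite gt_eqF.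
nra.
Qed.

Lemma Ex_lin (a b c : R) (f g h : V -> R) : bmeas f -> bmeas g -> bmeas h ->
  Ex (fun z => a * f z + b * g z + c * h z) = a * Ex f + b * Ex g + c * Ex h.
Proof.
move=> bf bg bh.
have bZ r k : bmeas k -> bmeas (fun z : V => r * k z).
  by move=> bk; apply: bmeasM => //; exact: bmeas_cst.
rewrite (ExD mu_unif (bmeasD (bZ a f bf) (bZ b g bg)) (bZ c h bh)).
rewrite (ExD mu_unif (bZ a f bf) (bZ b g bg)).
by rewrite (ExZ mu_unif a bf) (ExZ mu_unif b bg) (ExZ mu_unif c bh).
Qed.

(** Exchanging y and u symmetrizes the left-hand side into a mean of
    (t - s)^2 (up to a cutoff).  By rotation invariance this is as large as the mean
    of the square of each other Hopf coordinate, hence at least a third of that of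
    (s + t)^2. *)
Lemma Ex_anticorrelation (y u : 'cV[F]_n) : orthonormal2 y u ->
  72^-1 <= Ex (fun z => cutoff 24 (sq y z) * (sq u z - sq y z)).
Proof.
move=> on; have [ny nu yu] := on.
pose w z := sq y z + sq u z.
pose chi z := cutoff 24 (w z).
have bw : bmeas w by rewrite /w; bmeas_tac.
have bchi : bmeas chi by exact: bmeas_cutoff.
have bc x : bmeas (fun z : V => cutoff 24 (sq x z)) by bmeas_tac.
have s1 : Ex (fun z => cutoff 24 (sq u z) * (sq y z - sq u z)) =
          Ex (fun z => cutoff 24 (sq y z) * (sq u z - sq y z)).
  apply: (Ex_swap mu_unif (f := fun s t => cutoff 24 s * (t - s)) on).
  by bmeas_tac.
have s2 : Ex (fun z => (sq u z - sq y z) ^+ 2 * chi z / 24) <=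
    2 * Ex (fun z => cutoff 24 (sq y z) * (sq u z - sq y z)).
  rewrite mulr_natl mulr2n -{1}s1 -(ExD mu_unif); first last.
  - by bmeas_tac.
  - by bmeas_tac.
  apply: (Ex_le mu_unif) => [||z _].
  - by bmeas_tac.
  - by bmeas_tac.
  apply: le_trans (cutoff_slope _ (sq_ge0 y z) (sq_ge0 u z)) _ => //.
  by rewrite mulrBl addrC -mulrN opprB.
have s3 (om : F) : nsq om = 1 -> exists p q : 'cV[F]_n,
    (forall z, sq p z - sq q z = n%:R * (2 * reF (ip y z * conjF (om * ip u z)))) /\
    Ex (fun z => (sq p z - sq q z) ^+ 2 * chi z) =
    Ex (fun z => (sq u z - sq y z) ^+ 2 * chi z).
  move=> nom; have [p [q [Epq Dpq Bpq]]] := Ex_rotation mu_unif on nom.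
  exists p, q; split; first exact: Bpq.
  rewrite -(Epq (fun s t => (t - s) ^+ 2 * cutoff 24 (s + t))); last first.
    by bmeas_tac.
  by apply: Ex_eq => z _; rewrite Dpq -[in RHS](opprB (sq p z)) sqrrN.
have s4 : Ex (fun z => w z ^+ 2 * chi z) <=
    3 * Ex (fun z => (sq u z - sq y z) ^+ 2 * chi z).
  have [p [q [B1 E1]]] := s3 1 (nsq1 R K).
  have [p' [q' [B2 E2]]] := s3 _ (nsq_quarter R K).
  have bd x x' : bmeas (fun z : V => (sq x z - sq x' z) ^+ 2 * chi z).
    by bmeas_tac.
  have -> : 3 * Ex (fun z => (sq u z - sq y z) ^+ 2 * chi z) =
    Ex (fun z => 1 * ((sq u z - sq y z) ^+ 2 * chi z)
      + 1 * ((sq p z - sq q z) ^+ 2 * chi z)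
      + 1 * ((sq p' z - sq q' z) ^+ 2 * chi z)).
    by rewrite (Ex_lin 1 1 1 (bd u y) (bd p q) (bd p' q')) E1 E2; ring.
  apply: (Ex_le mu_unif) => [||z _].
  - by bmeas_tac.
  - by bmeas_tac.
  rewrite !(mul1r (_ * chi z)) -2!mulrDl.
  apply: ler_wpM2r; first exact: cutoff_ge0.
  rewrite B1 B2 mul1r.
  have := hopf_le (ip y z) (ip u z); rewrite /w /sq.
  move: (reF _) (reF _) (nsq (ip y z)) (nsq (ip u z)) (n%:R : R) => r r' s t N h.
  have -> : (N * s + N * t) ^+ 2 = N ^+ 2 * (s + t) ^+ 2 by ring.
  apply: le_trans (ler_wpM2l (sqr_ge0 N) h) _.
  by rewrite le_eqVlt; apply/orP; left; apply/eqP; ring.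
have s5 : 2 <= Ex (fun z => w z ^+ 2 * chi z).
  have bw2 : bmeas (fun z => w z ^+ 2) by exact: bmeasX.
  have by2 : bmeas (fun z : V => sq y z ^+ 2) by bmeas_tac.
  have bu2 : bmeas (fun z : V => sq u z ^+ 2) by bmeas_tac.
  have b1 : bmeas (fun _ : V => 1 : R) by exact: bmeas_cst.
  have h1 : Ex (fun z => 2 * w z + (- (2 / 24)) * w z ^+ 2 + (-1) * 1) <=
      Ex (fun z => w z ^+ 2 * chi z).
    apply: (Ex_le mu_unif) => [||z _].
    - by bmeas_tac.
    - by bmeas_tac.
    apply: le_trans (sqr_cutoff_ge _ _); rewrite ?addr_ge0 ?sq_ge0//.
    by rewrite mulr1 mulNr addrAC.
  have h2 : Ex (fun z => w z ^+ 2) <=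
      Ex (fun z => 2 * sq y z ^+ 2 + 2 * sq u z ^+ 2 + 0 * 1).
    apply: (Ex_le mu_unif) => [||z _]; [exact: bw2|by bmeas_tac|].
    rewrite /w; have := sqr_ge0 (sq y z - sq u z).
    by move: (sq y z) (sq u z) => s t; clear -mu_unif n_gt0; nra.
  have wE : Ex w = 2.
    by rewrite (ExD mu_unif (bmeas_sq y) (bmeas_sq u)) !(Ex_sq mu_unif n_gt0).
  rewrite (Ex_lin 2 (- (2 / 24)) (-1) bw bw2 b1) wE (Ex_cst mu_unif) in h1.
  rewrite (Ex_lin 2 2 0 by2 bu2 b1) in h2.
  move: (Ex_sq2 mu_unif n_gt0 ny) (Ex_sq2 mu_unif n_gt0 nu).
  by move: h1 h2; Ex_lra.
have : Ex (fun z => (sq u z - sq y z) ^+ 2 * chi z / 24) =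
    24^-1 * Ex (fun z => (sq u z - sq y z) ^+ 2 * chi z).
  rewrite -(ExZ mu_unif); last by bmeas_tac.
  by apply: Ex_eq => z _; rewrite mulrC.
by move: s2 s4 s5; Ex_lra.
Qed.

Lemma trace_test_ge (A e M s t : R) : 0 < A -> 0 < M -> 0 <= e <= 1 ->
  0 <= s -> 0 <= t ->
  cutoff A s * (t - s) - e * t - (4 * M)^-1 * t ^+ 2 <= trace_test A (1 - e) M s t.
Proof.
move=> A0 M0 /andP[e0 e1] s0 t0.
rewrite /trace_test [leRHS]mulrBr (cutoff_min _ id)// mulrBr /=.
have mt : t - (4 * M)^-1 * t ^+ 2 <= Num.min t M.
  apply: le_trans (gauss_mean_le_min t M0); rewrite /gauss_mean.
  by rewrite le_eqVlt; apply/orP; left; apply/eqP; field; rewrite gt_eqF.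
have M4 : 0 <= (4 * M)^-1 by rewrite invr_ge0 mulr_ge0// ltW.
move: (cutoff_ge0 A s) (cutoff_le1 A0 s0) mt (mulr_ge0 M4 (sqr_ge0 t)).
move: (cutoff _ _) (Num.min _ _) ((4 * M)^-1 * t ^+ 2) => c m q c0 c1 mt q0.
have h1 : c * ((1 - e) * (t - q)) <= c * ((1 - e) * m).
  by rewrite ler_wpM2l// ler_wpM2l// subr_ge0.
have h2 : c * (e * t + (1 - e) * q) <= e * t + (1 - e) * q.
  by rewrite ler_piMl// addr_ge0// mulr_ge0// subr_ge0.
have h3 : (1 - e) * q <= q by rewrite ler_piMl// gerBl.
by move: h1 h2 h3; clear -R; lra.
Qed.

Lemma sign_test_ge (kap M s t : R) : 0 <= kap -> 0 < M -> 0 <= s -> 0 <= t ->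
  s - 7 / (4 * M) * s ^+ 2 - kap * t <= sign_test kap M s t.
Proof.
move=> k0 M0 s0 t0.
rewrite /sign_test mulrBr (cutoff_min _ (fun t => t - 3 * t ^+ 2 / (4 * M)))//.
have mt : Num.min (kap * t) M <= kap * t by rewrite ge_min lexx.
have m0 : 0 <= Num.min (kap * t) M by rewrite le_min mulr_ge0// ltW.
have M4 : 0 <= M^-1 by rewrite invr_ge0 ltW.
have -> : 7 / (4 * M) * s ^+ 2 = 7 / 4 * (M^-1 * s ^+ 2) by field; rewrite gt_eqF.
have -> : 3 * s ^+ 2 / (4 * M) = 3 / 4 * (M^-1 * s ^+ 2) by field; rewrite gt_eqF.
have hs : s - M^-1 * s ^+ 2 <= cutoff M s * s.
  have := ler_wpM2r s0 (cutoff_ge M s); apply: le_trans.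
  by rewrite le_eqVlt; apply/orP; left; apply/eqP; ring.
move: (cutoff_ge0 M s) (cutoff_le1 M0 s0) hs (mulr_ge0 M4 (sqr_ge0 s)).
move: (cutoff _ _) (Num.min _ _) (M^-1 * s ^+ 2) mt m0 => c m q mt m0 c0 c1 hs q0.
have h1 : c * m <= kap * t by apply: le_trans mt; rewrite ler_piMl.
have h2 : c * q <= q by rewrite ler_piMl.
by move: h1 h2 hs; clear -R; lra.
Qed.

Lemma Ex_trace_test (y u : 'cV[F]_n) : orthonormal2 y u ->
  1000^-1 <= Ex (fun z => trace_test 24 (1 - 100^-1) 1000 (sq y z) (sq u z)).
Proof.
move=> on; have [ny nu yu] := on.
have bg : bmeas (fun z : V => cutoff 24 (sq y z) * (sq u z - sq y z)) by bmeas_tac.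
have bu2 : bmeas (fun z : V => sq u z ^+ 2) by bmeas_tac.
have h : Ex (fun z => 1 * (cutoff 24 (sq y z) * (sq u z - sq y z))
    + (- 100^-1) * sq u z + (- (4 * 1000)^-1) * sq u z ^+ 2) <=
  Ex (fun z => trace_test 24 (1 - 100^-1) 1000 (sq y z) (sq u z)).
  apply: (Ex_le mu_unif) => [||z _].
  - by bmeas_tac.
  - by rewrite /trace_test; bmeas_tac.
  rewrite mul1r !mulNr; apply: trace_test_ge; rewrite ?sq_ge0 ?ltr0n//.
  by rewrite invr_ge0 ler0n invf_le1 ?ltr0n// ler1n.
rewrite (Ex_lin _ _ _ bg (bmeas_sq u) bu2) (Ex_sq mu_unif n_gt0 nu) in h.
apply: le_trans h.
by move: (Ex_sq2 mu_unif n_gt0 nu) (Ex_anticorrelation on); Ex_lra.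
Qed.

Lemma Ex_sign_test (y u : 'cV[F]_n) : orthonormal2 y u ->
  1000^-1 <= Ex (fun z => sign_test (1 - 100^-1) 1000 (sq y z) (sq u z)).
Proof.
move=> on; have [ny nu yu] := on.
have by2 : bmeas (fun z : V => sq y z ^+ 2) by bmeas_tac.
have h : Ex (fun z => 1 * sq y z + (- (7 / (4 * 1000))) * sq y z ^+ 2
    + (- (1 - 100^-1)) * sq u z) <=
  Ex (fun z => sign_test (1 - 100^-1) 1000 (sq y z) (sq u z)).
  apply: (Ex_le mu_unif) => [||z _].
  - by bmeas_tac.
  - by rewrite /sign_test; bmeas_tac.
  rewrite mul1r !mulNr; apply: sign_test_ge; rewrite ?sq_ge0 ?ltr0n//.
  by rewrite subr_ge0 invf_le1 ?ltr0n// ler1n.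
rewrite (Ex_lin _ _ _ (bmeas_sq y) by2 (bmeas_sq u)) in h.
rewrite (Ex_sq mu_unif n_gt0 ny) (Ex_sq mu_unif n_gt0 nu) in h.
apply: le_trans h.
by move: (Ex_sq2 mu_unif n_gt0 ny); Ex_lra.
Qed.

End TestMeans.

(** * Chernoff bound for counts of independent events *)

Section Counting.
Variables (R : realType) (d d' : measure_display).
Variables (T : measurableType d) (T' : measurableType d') (P : probability T R).
Local Open Scope ereal_scope.

Lemma bigsetU_le (I : Type) (r : seq I) (A : I -> set T) (b : R) :
  (forall i, measurable (A i)) -> (forall i, P (A i) <= b%:E) ->
  P (\big[setU/set0]_(i <- r) A i) <= ((size r)%:R * b)%:E.
Proof.
move=> mA Ab; elim: r => [|i r IH]; first by rewrite big_nil measure0 mul0r.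
rewrite big_cons /=; apply: le_trans (measureU2 _ _ _) _ => //.
  exact: bigsetU_measurable.
by rewrite -natr1 mulrDl mul1r addrC EFinD; exact: (leeD IH (Ab i)).
Qed.

Definition Ep (f : T -> R) : R := (\int[P]_w f w)%R.

Lemma indic_integrable (A : set T) (r : R) : measurable A ->
  P.-integrable setT (EFin \o (fun w => r * \1_A w)%R).
Proof.
move=> mA; apply: measurable_bounded_integrable => //.
- by apply: le_lt_trans (ltry 1); exact: probability_le1.
- by apply: measurable_funM => //; exact: measurable_indic.
- exists `|r|%R; split => [|M rM w _ /=]; first exact: num_real.
  apply: le_trans (ltW rM); rewrite normrM ler_piMr// indicE ger0_norm//.
  by case: (_ \in _).
Qed.

Lemma Ep_indic (A : set T) (r : R) : measurable A ->
  Ep (fun w => r * \1_A w)%R = (r * fine (P A))%R.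
Proof.
move=> mA; rewrite /Ep RintegralZl//; last first.
  have := indic_integrable 1 mA; congr (integrable _ _ _).
  by apply/funext => w /=; rewrite mul1r.
by rewrite /Rintegral integral_indic// setIT.
Qed.

Lemma Ep_sum (I : Type) (r : seq I) (c : I -> R) (A : I -> set T) :
  (forall i, measurable (A i)) ->
  P.-integrable setT (EFin \o (fun w => \sum_(i <- r) c i * \1_(A i) w)%R) /\
  Ep (fun w => \sum_(i <- r) c i * \1_(A i) w)%R =
  (\sum_(i <- r) c i * fine (P (A i)))%R.
Proof.
move=> mA; elim: r => [|i r [IH1 IH2]].
  have e : (fun w => \sum_(i <- [::]) c i * \1_(A i) w)%R =
      (fun w : T => 0 * \1_(@set0 T) w)%R.
    by apply/funext => w; rewrite big_nil mul0r.
  by rewrite e Ep_indic// mul0r big_nil; split => //; exact: indic_integrable.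
have e : (fun w => \sum_(i <- i :: r) c i * \1_(A i) w)%R =
   (fun w => c i * \1_(A i) w + \sum_(i <- r) c i * \1_(A i) w)%R.
  by apply/funext => w; rewrite big_cons.
rewrite e; split.
  exact: integrableD (indic_integrable _ (mA i)) IH1.
rewrite /Ep RintegralD//; last exact: indic_integrable.
by rewrite -/(Ep _) -/(Ep _) Ep_indic// IH2 big_cons.
Qed.

End Counting.

Section Hoeffding.
Variables (R : realType) (d d' : measure_display).
Variables (T : measurableType d) (T' : measurableType d') (P : probability T R).
Variables (m : nat) (z : 'I_m -> {RV P >-> T'}).
Hypothesis z_indep : mutually_independent z.
Variables (B : 'I_m -> set T').
Hypothesis mB : forall i, measurable (B i).

Definition hit (i : 'I_m) : set T := [set w | B i (z i w)].
Definition hit_prob i : R := fine (P (hit i)).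

Lemma hit_measurable i : measurable (hit i).
Proof.
rewrite -[hit i]setTI.
have mz : measurable_fun setT (z i) by exact: measurable_funP.
exact: mz measurableT (B i) (mB i).
Qed.

Lemma hit_probE i : P (hit i) = (hit_prob i)%:E.
Proof. by rewrite fineK// fin_num_measure//; exact: hit_measurable. Qed.

Lemma hit_prob_ge0 i : 0 <= hit_prob i.
Proof. exact/fine_ge0. Qed.

Lemma hit_prob_le1 i : hit_prob i <= 1.
Proof.
by rewrite -lee_fin -hit_probE; apply: probability_le1; exact: hit_measurable.
Qed.

(** The generating function of a count of independent events: expanding the
    product over subsets turns independence into multiplicativity. *)
Lemma count_mgf (q : R) :
  P.-integrable setT (EFin \o (fun w => \prod_i (1 - q * \1_(hit i) w))) /\
  Ep P (fun w => \prod_i (1 - q * \1_(hit i) w)) = \prod_i (1 - q * hit_prob i).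
Proof.
pose A (J : {set 'I_m}) : set T := [set w | forall i, i \in J -> hit i w].
have mA J : measurable (A J).
  have -> : A J = \bigcap_(i in [set i | i \in J]) hit i by [].
  by apply: fin_bigcap_measurable => // i _; exact: hit_measurable.
have PA J : fine (P (A J)) = \prod_(i in J) hit_prob i.
  rewrite /A (z_indep J mB).
  have -> : (\prod_(i in J) P [set w | B i (z i w)] = \prod_(i in J) (hit_prob i)%:E)%E.
    by apply: eq_bigr => i _; exact: hit_probE.
  by rewrite prodEFin.
have expand (x : 'I_m -> R) : \prod_i (1 - q * x i) =
    \sum_(J : {set 'I_m}) (- q) ^+ #|J| * \prod_(i in J) x i.
  under eq_bigr do rewrite addrC -mulNr.
  rewrite bigA_distr; apply: eq_bigr => J _.
  transitivity (\prod_(i in J) (- q * x i) * \prod_(i in ~: J) 1).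
    rewrite (bigID (mem J)) /=; congr (_ * _).
      by apply: eq_bigr => i ->.
    by apply: eq_big => [i|i /negPf ->] //; rewrite inE.
  by rewrite big1_eq mulr1 big_split /= prodr_const.
have e : (fun w => \prod_i (1 - q * \1_(hit i) w)) =
    (fun w => \sum_(J : {set 'I_m}) (- q) ^+ #|J| * \1_(A J) w).
  apply/funext => w; rewrite expand; apply: eq_bigr => J _; congr (_ * _).
  rewrite [RHS]indicE; have [AJ|AJ] := pselect (A J w).
    rewrite mem_set// big1// => i iJ; rewrite indicE mem_set//; exact: AJ.
  rewrite memNset//; move: AJ; rewrite /A /= => /existsNP[i /not_implyP[iJ hi]].
  by rewrite (bigD1 i)//= indicE memNset ?mul0r.
rewrite e; have [h1 h2] := Ep_sum P (index_enum _) (fun J : {set 'I_m} => (- q) ^+ #|J|) mA.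
split; first exact: h1.
by rewrite h2 expand; apply: eq_bigr => J _; rewrite PA.
Qed.

Definition hit_count (w : T) : R := \sum_i \1_(hit i) w.

Lemma count_measurable : measurable_fun setT hit_count.
Proof.
by apply: measurable_sum => i; apply: measurable_indic; exact: hit_measurable.
Qed.

Lemma count_lower_tail (eta : R) : 0 < eta <= 2 ->
  (P [set w | (hit_count w <= \sum_i hit_prob i - eta * m%:R)%R] <=
    (expR (- (eta ^+ 2 * m%:R / 4)))%:E)%E.
Proof.
move=> /andP[eta0 eta2].
pose t := eta / 2; have t0 : 0 < t by rewrite divr_gt0.
have t1 : t <= 1 by rewrite ler_pdivrMr// mul1r.
pose q := 1 - expR (- t); set s := \sum_i hit_prob i; pose a := s - eta * m%:R.
have q_ge : t - t ^+ 2 <= q.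
  have h : expR (- t) <= (1 + t)^-1.
    by rewrite expRN lef_pV2 ?posrE ?expR_gt0 ?expR_ge1Dx// addr_gt0.
  have h2 : (1 + t)^-1 <= 1 - t + t ^+ 2.
    rewrite -[leLHS]mul1r ler_pdivrMr ?addr_gt0//.
    have -> : (1 - t + t ^+ 2) * (1 + t) = 1 + t ^+ 3 by ring.
    by rewrite lerDl exprn_ge0// ltW.
  by rewrite /q; lra.
have qp i : expR (- (q * hit_prob i)) >= 1 - q * hit_prob i by exact: expR_ge1Dx.
have q1 : q <= 1 by rewrite gerBl expR_ge0.
set A := [set w | _]; have mA : measurable A.
  rewrite -[A]setTI.
  have -> : A = hit_count @^-1` `]-oo, a] by rewrite preimage_itvNyc.
  exact: count_measurable.
have [int1 E1] := count_mgf q.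
have prodE w : \prod_i (1 - q * \1_(hit i) w) = expR (- (t * hit_count w)).
  rewrite /hit_count mulr_sumr -sumrN expR_sum; apply: eq_bigr => i _.
  rewrite indicE; case: (_ \in _) => /=.
    by rewrite !mulr1 /q opprB addrC subrK.
  by rewrite !mulr0 oppr0 expR0 addr0.
have : expR (- (t * a)) * fine (P A) <= \prod_i (1 - q * hit_prob i).
  rewrite -E1 -Ep_indic//; apply: le_Rintegral => //; first exact: indic_integrable.
  move=> w _; rewrite prodE indicE; have [Aw|Aw] := pselect (A w).
    rewrite mem_set// mulr1 ler_expR lerN2 ler_pM2l//; exact: Aw.
  by rewrite memNset// mulr0 expR_ge0.
have -> : P A = (fine (P A))%:E by rewrite fineK// fin_num_measure.
move=> h; rewrite lee_fin.
have {}h : fine (P A) <= expR (t * a) * \prod_i (1 - q * hit_prob i).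
  by rewrite -ler_pdivrMl ?expR_gt0// -expRN.
apply: le_trans h _.
apply: (@le_trans _ _ (expR (t * a) * expR (- (q * s)))).
  rewrite ler_wpM2l ?expR_ge0// /s mulr_sumr -sumrN expR_sum.
  apply: ler_prod => i _; rewrite qp andbT subr_ge0 mulr_ile1 ?hit_prob_ge0 ?hit_prob_le1//.
  by rewrite (le_trans _ q_ge)// expr2 -[X in X - _]mulr1 -mulrBr mulr_ge0 ?subr_ge0// ltW.
rewrite -expRD ler_expR.
have s0 : 0 <= s by apply: sumr_ge0 => i _; exact: hit_prob_ge0.
have sm : s <= m%:R.
  rewrite -[X in X%:R]card_ord -sumr_const; apply: ler_sum => i _.
  exact: hit_prob_le1.
have h1 : (t - t ^+ 2) * s <= q * s by rewrite ler_wpM2r.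
have h2 : t ^+ 2 * s <= t ^+ 2 * m%:R by rewrite ler_wpM2l// sqr_ge0.
have -> : eta ^+ 2 * m%:R / 4 = t ^+ 2 * m%:R by rewrite /t; field.
have e : eta = 2 * t by rewrite /t; field.
by move: h1 h2; rewrite /a e; lra.
Qed.

End Hoeffding.

(** * Sums of bounded functions of a sample *)

Section Staircase.
Variable R : realType.

(** The integer part of x, capped at L, written as a sum of indicators. *)
Definition staircase (L : nat) (x : R) : R := \sum_(l < L) (l.+1%:R <= x)%R%:R.

Lemma staircase_le L x : 0 <= x -> staircase L x <= Num.min x L%:R.
Proof.
move=> x0; elim: L => [|L IH]; first by rewrite /staircase big_ord0 le_min x0 lexx.
rewrite /staircase big_ord_recr /= -/(staircase L x).
move: IH; rewrite !le_min => /andP[h1 h2]; have [h|h] := leP L.+1%:R x => /=.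
  by rewrite -natr1 in h *; apply/andP; split; lra.
by rewrite addr0 h1 /= (le_trans h2)// ler_nat.
Qed.

Lemma staircase_ge L x : Num.min x L.+1%:R - 1 <= staircase L x.
Proof.
elim: L => [|L IH]; first by rewrite /staircase big_ord0 subr_le0 ge_min lexx orbT.
rewrite /staircase big_ord_recr /= -/(staircase L x).
have [h|h] := leP L.+1%:R x => /=.
  have := IH; rewrite min_r// => {}IH.
  have : Num.min x L.+2%:R <= L.+2%:R by rewrite ge_min lexx orbT.
  by move: IH; rewrite -!natr1; lra.
rewrite addr0; rewrite (min_l (ltW h)) in IH.
have -> : Num.min x L.+2%:R = x by rewrite min_l// (le_trans (ltW h))// ler_nat.
exact: IH.
Qed.

End Staircase.

Section BoundedSums.
Variables (R : realType) (d d' : measure_display).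
Variables (T : measurableType d) (T' : measurableType d') (P : probability T R).
Variables (m : nat) (z : 'I_m -> {RV P >-> T'}).
Hypothesis z_indep : mutually_independent z.

Definition level (G : T' -> R) (h : R) (l : nat) : set T' :=
  [set x | l.+1%:R * h <= G x].

Lemma level_measurable G h l : measurable_fun setT G -> measurable (level G h l).
Proof.
move=> mG; rewrite -[level _ _ _]setTI.
have -> : level G h l = G @^-1` `[l.+1%:R * h, +oo[.
  by rewrite preimage_itvcy.
exact: mG.
Qed.

Lemma level_staircase G h L x : 0 < h ->
  \sum_(l < L) \1_(level G h l) x = staircase L (G x / h).
Proof.
move=> h0; apply: eq_bigr => l _; rewrite indicE ler_pdivlMr//.
by rewrite /level; congr ((nat_of_bool _)%:R); apply/idP/idP; rewrite inE.
Qed.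

(** The sum over the sample is at least h times the sum of the counts of the
    levels, and each count is controlled by the Chernoff bound. *)
Lemma bounded_sum_lower_tail (G : T' -> R) (h : R) (L : nat) (eta : R) :
  measurable_fun setT G -> 0 < h -> (forall x, 0 <= G x) -> 0 < eta <= 2 ->
  exists Bad : set T, [/\ measurable Bad,
    (P Bad <= (L%:R * expR (- (eta ^+ 2 * m%:R / 4)))%:E)%E &
    forall w, ~ Bad w ->
    h * (\sum_(l < L) \sum_i fine (P [set w | level G h l (z i w)])) -
      h * L%:R * eta * m%:R <= \sum_i G (z i w)].
Proof.
move=> mG h0 G0 eta01.
pose B (l : 'I_L) := fun i : 'I_m => level G h l.
have mB l i : measurable (B l i) by exact: level_measurable.
pose bad l := [set w | hit_count z (B l) w <= \sum_i hit_prob z (B l) i - eta * m%:R].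
have mbad l : measurable (bad l).
  rewrite -[bad l]setTI.
  have -> : bad l = hit_count z (B l) @^-1`
      `]-oo, (\sum_i hit_prob z (B l) i - eta * m%:R)].
    by rewrite preimage_itvNyc.
  exact: count_measurable.
exists (\big[setU/set0]_(l <- enum 'I_L) bad l); split.
- exact: bigsetU_measurable.
- have tail l : (P (bad l) <= (expR (- (eta ^+ 2 * m%:R / 4)))%:E)%E.
    exact: count_lower_tail.
  by have := bigsetU_le (enum 'I_L) mbad tail; rewrite size_enum_ord.
- move=> w nbad.
  have good l : \sum_i hit_prob z (B l) i - eta * m%:R <= hit_count z (B l) w.
    rewrite leNgt; apply/negP => lt; apply: nbad.
    by rewrite -bigcup_seq; exists l; rewrite /= ?mem_enum// /bad /= ltW.
  have low : h * (\sum_(l < L) hit_count z (B l) w) <= \sum_i G (z i w).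
    rewrite /hit_count exchange_big mulr_sumr; apply: ler_sum => i _ /=.
    have -> : \sum_(l < L) \1_(hit z (B l) i) w =
        \sum_(l < L) \1_(level G h l) (z i w) :> R.
      by apply: eq_bigr => l _; rewrite !indicE; congr ((nat_of_bool _)%:R);
        apply/idP/idP; rewrite !inE.
    rewrite level_staircase// mulrC -ler_pdivlMr//.
    apply: le_trans (staircase_le _ _) _; first by rewrite divr_ge0// ltW.
    by rewrite ge_min lexx.
  apply: le_trans low; rewrite -!mulrA -mulrBr ler_pM2l//.
  rewrite mulr_natl -[X in _ *+ X]card_ord -sumr_const -sumrB.
  by apply: ler_sum => l _; exact: good.
Qed.

End BoundedSums.

Section SphereSums.
Variables (R : realType) (K : base_field) (n : nat).
Local Notation V := (vecF R K n).

Lemma Ex_levels (mu : probability V R) (G : V -> R) (h : R) (L : nat) :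
  uniform_on_sphere mu -> bmeas G -> 0 < h -> (forall x, 0 <= G x <= h * L%:R) ->
  sphere_mean mu G - h <= h * \sum_(l < L) fine (mu (level G h l)).
Proof.
move=> mu_unif bG h0 GL.
have mG : measurable_fun setT G by case: bG.
have bl l : bmeas (fun x => \1_(level G h l) x : R).
  split; first by apply: measurable_indic; exact: level_measurable.
  by exists 1 => x _; rewrite indicE ger0_norm//; case: (_ \in _).
have Exl l : sphere_mean mu (\1_(level G h l)) <= fine (mu (level G h l)).
  have ml := level_measurable h l mG.
  rewrite /sphere_mean /Rintegral integral_indic//; last exact: unit_sphere_measurable.
  apply: fine_le; rewrite ?fin_num_measure//; last first.
    by apply: le_measure => //; rewrite ?inE//; apply: measurableI => //;
      exact: unit_sphere_measurable.
  by apply: measurableI => //; exact: unit_sphere_measurable.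
apply: (@le_trans _ _ (h * \sum_(l < L) sphere_mean mu (\1_(level G h l)))); last first.
  by rewrite ler_pM2l//; apply: ler_sum => l _.
rewrite -(Ex_sum mu_unif) => [|l]; last exact: bl.
rewrite -(ExZ mu_unif); last by apply: bmeas_sum.
rewrite -[X in _ - X](Ex_cst mu_unif) -(ExB mu_unif) => //; last exact: bmeas_cst.
apply: (Ex_le mu_unif) => [||x _].
- by apply: bmeasD => //; apply: bmeasN; exact: bmeas_cst.
- by apply: bmeasM; [exact: bmeas_cst|exact: bmeas_sum].
rewrite level_staircase//; have := staircase_ge L (G x / h).
have /andP[G0 Gh] := GL x.
rewrite min_l; last first.
  by rewrite ler_pdivrMr// (le_trans Gh)// mulrC ler_pM2r// ler_nat.
by move=> H; have := ler_wpM2l (ltW h0) H; rewrite mulrBr mulr1 mulrCA mulfV ?mulr1// gt_eqF.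
Qed.

End SphereSums.

(** * Bounded Lipschitz functions and nets *)

Section BoundedLipschitz.
Variable R : realType.
Implicit Types (f g : R -> R -> R) (b c : R).

(** On the quadrant only, where the squared coordinates take their values. *)
Definition bounded_lipschitz f := exists b c, [/\ 0 <= b, 0 <= c,
  forall s t, 0 <= s -> 0 <= t -> `|f s t| <= b &
  forall s t s' t', 0 <= s -> 0 <= t -> 0 <= s' -> 0 <= t' ->
    `|f s t - f s' t'| <= c * (`|s - s'| + `|t - t'|)].

Lemma bl_cst r : bounded_lipschitz (fun _ _ => r).
Proof.
exists `|r|, 0; split => // s t s' t' *.
by rewrite subrr normr0 mul0r.
Qed.

Lemma blD f g : bounded_lipschitz f -> bounded_lipschitz g ->
  bounded_lipschitz (fun s t => f s t + g s t).
Proof.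
move=> [b [c [b0 c0 fb fc]]] [b' [c' [b0' c0' gb gc]]].
exists (b + b'), (c + c'); split; [exact: addr_ge0|exact: addr_ge0| |].
  move=> s t s0 t0.
  by apply: le_trans (ler_normD _ _) _; rewrite lerD ?fb ?gb.
move=> s t s' t' s0 t0 s0' t0'; rewrite mulrDl opprD addrACA.
by apply: le_trans (ler_normD _ _) _; rewrite lerD ?fc ?gc.
Qed.

Lemma blM f g : bounded_lipschitz f -> bounded_lipschitz g ->
  bounded_lipschitz (fun s t => f s t * g s t).
Proof.
move=> [b [c [b0 c0 fb fc]]] [b' [c' [b0' c0' gb gc]]].
exists (b * b'), (b * c' + b' * c); split.
- by rewrite mulr_ge0.
- by rewrite addr_ge0 ?mulr_ge0.
- by move=> s t s0 t0; rewrite normrM ler_pM ?fb ?gb.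
move=> s t s' t' s0 t0 s0' t0'.
have -> : f s t * g s t - f s' t' * g s' t' =
  f s t * (g s t - g s' t') + g s' t' * (f s t - f s' t') by ring.
apply: le_trans (ler_normD _ _) _; rewrite !normrM mulrDl -!mulrA.
by rewrite lerD// ler_pM ?fb ?gb ?fc ?gc.
Qed.

Lemma blN f : bounded_lipschitz f -> bounded_lipschitz (fun s t => - f s t).
Proof.
move=> [b [c [b0 c0 fb fc]]]; exists b, c; split; first exact: b0.
- exact: c0.
- by move=> s t s0 t0; rewrite normrN fb.
- by move=> s t s' t' *; rewrite -opprD normrN fc.
Qed.

Lemma bl_swap f : bounded_lipschitz f -> bounded_lipschitz (fun s t => f t s).
Proof.
move=> [b [c [b0 c0 fb fc]]]; exists b, c; split; first exact: b0.
- exact: c0.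
- by move=> s t s0 t0; exact: fb.
- by move=> s t s' t' *; rewrite (addrC `|s - s'|); exact: fc.
Qed.

Lemma bl_min M : 0 <= M -> bounded_lipschitz (fun s _ => Num.min s M).
Proof.
move=> M0; exists M, 1; split; [exact: M0|exact: ler01| |].
  by move=> s t s0 t0; rewrite ger0_norm ?le_min ?s0// ge_min lexx orbT.
move=> s t s' t' s0 t0 s0' t0'.
rewrite mul1r; apply: le_trans (_ : `|s - s'| <= _); last by rewrite lerDl.
have [h|h] := leP s M; have [h'|h'] := leP s' M => //.
- rewrite ler0_norm ?subr_le0// ler0_norm ?subr_le0 ?(le_trans h (ltW h'))//.
  by rewrite lerN2 lerD2l lerN2 ltW.
- rewrite ger0_norm ?subr_ge0// ger0_norm ?subr_ge0 ?(le_trans h' (ltW h))//.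
  by rewrite lerD2r ltW.
- by rewrite subrr normr0.
Qed.

Lemma bl_cutoff A : 0 < A -> bounded_lipschitz (fun s _ => cutoff A s).
Proof.
move=> A0.
have -> : (fun s _ : R => cutoff A s) = (fun s _ => 1 + - (A^-1 * Num.min s A)).
  apply/funext => s; apply/funext => _; rewrite /cutoff.
  have [h|h] := leP s A.
    by rewrite max_r ?subr_ge0 ?ler_pdivrMr ?mul1r// mulrC.
  by rewrite mulVf ?gt_eqF// subrr max_l// subr_le0 ler_pdivlMr// mul1r ltW.
apply: blD (bl_cst _) _; apply: blN; apply: blM (bl_cst _) _.
exact: bl_min (ltW A0).
Qed.

Lemma bl_min_scaled k M : 0 <= k -> 0 <= M ->
  bounded_lipschitz (fun _ t => Num.min (k * t) M).
Proof.
move=> k0 M0; have [b [c [b0 c0 fb fc]]] := bl_min M0.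
exists b, (c * k); split; [exact: b0|exact: mulr_ge0| |].
  by move=> s t s0 t0; apply: (fb _ 0); rewrite ?mulr_ge0.
move=> s t s' t' s0 t0 s0' t0'.
apply: le_trans (fc _ 0 _ 0 _ _ _ _) _; rewrite ?mulr_ge0//.
rewrite -mulrBr normrM (ger0_norm k0) subrr normr0 addr0 -mulrA ler_wpM2l//.
by rewrite ler_wpM2l// lerDr.
Qed.

Lemma bl_trace_test A kap M : 0 < A -> 0 <= M ->
  bounded_lipschitz (trace_test A kap M).
Proof.
move=> A0 M0; rewrite /trace_test; apply: blM (bl_cutoff A0) _.
apply: blD; last exact: blN (bl_min (ltW A0)).
by apply: blM (bl_cst _) _; apply: bl_swap (fun s _ => Num.min s M) _; exact: bl_min.
Qed.

Lemma bl_sign_test kap M : 0 <= kap -> 0 < M -> bounded_lipschitz (sign_test kap M).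
Proof.
move=> k0 M0; have bm := bl_min (ltW M0).
rewrite /sign_test; apply: blM (bl_cutoff M0) _.
apply: blD; last by apply: blN; apply: bl_min_scaled => //; exact: ltW.
apply: (blD bm); apply: blN.
by apply: blM (blM (bl_cst _) _) (bl_cst _); apply: (blM bm bm).
Qed.

End BoundedLipschitz.

Section Net.
Variables (R : realType) (K : base_field).
Local Notation F := (fieldF R K).

Definition imF : F -> R :=
  match K return fieldF R K -> R with
  | RealField => fun=> 0
  | ComplexField => fun a : R[i] => complex.Im a
  end.

Lemma nsq_re_im (a : F) : nsq a = reF a ^+ 2 + imF a ^+ 2.
Proof. by rewrite /nsq /reF /imF; case: K a => a //; rewrite expr0n addr0. Qed.

Lemma imFB (a b : F) : imF (a - b) = imF a - imF b.
Proof. by rewrite /imF; case: K a b => a b; rewrite ?subr0//; case: a; case: b. Qed.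

Definition coordF (im : bool) (a : F) : R := if im then imF a else reF a.

Lemma coordFB im a b : coordF im (a - b) = coordF im a - coordF im b.
Proof. by case: im; rewrite /coordF ?imFB ?raddfB. Qed.

Lemma coordF_le1 im a : nsq a <= 1 -> -1 <= coordF im a <= 1.
Proof.
rewrite nsq_re_im => a1; rewrite -ler_norml -(@ler_pXn2r _ 2) ?nnegrE//.
rewrite expr1n real_normK ?num_real//; apply: le_trans a1.
by case: im; rewrite /= ?lerDr ?lerDl sqr_ge0.
Qed.

Definition grid (Q : nat) (r : R) : 'I_(2 * Q).+1 := inord (Num.truncn ((r + 1) * Q%:R)).

Lemma grid_close Q (r r' : R) : (0 < Q)%N -> -1 <= r <= 1 -> -1 <= r' <= 1 ->
  grid Q r = grid Q r' -> (r - r') ^+ 2 <= Q%:R ^- 2.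
Proof.
move=> Q0 hr hr' /(congr1 (@nat_of_ord _)).
have Q0' : 0 < Q%:R :> R by rewrite ltr0n.
have pos (x : R) : -1 <= x <= 1 -> 0 <= (x + 1) * Q%:R :> R.
  by move=> /andP[x1 _]; rewrite mulr_ge0 ?(ltW Q0')//; move: x1; lra.
have bnd (x : R) : -1 <= x <= 1 -> (Num.truncn ((x + 1) * Q%:R) < (2 * Q).+1)%N.
  move=> hx; have /andP[h _] := truncn_itv (pos x hx).
  rewrite ltnS -(@ler_nat R); apply: le_trans h _; rewrite natrM ler_pM2r//.
  by case/andP: hx; lra.
rewrite !inordK ?bnd// => e.
have /andP[h1 h2] := truncn_itv (pos r hr).
have /andP[h1' h2'] := truncn_itv (pos r' hr').
move: h1 h2; rewrite e => h1 h2; move: h2 h2'; rewrite -!natr1 => h2 h2'.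
have : `|(r - r') * Q%:R| <= 1.
  have -> : (r - r') * Q%:R = (r + 1) * Q%:R - (r' + 1) * Q%:R by ring.
  rewrite ler_norml; move: h1 h2 h1' h2'.
  by move: (_ * Q%:R) (_ * Q%:R) (_%:R) => a b k *; apply/andP; split; lra.
rewrite -(@ler_pXn2r _ 2) ?nnegrE// expr1n real_normK ?num_real// exprMn => h.
by rewrite -[leLHS](mulfK (_ : Q%:R ^+ 2 != 0)) ?expf_neq0 ?gt_eqF//
  ler_pdivrMr ?exprn_gt0// mulVf// expf_neq0 ?gt_eqF.
Qed.

Variable n : nat.

(** The cell of a pair of vectors in a grid of mesh 1 / Q: the key of a coordinate
    tells its index, whether it is an imaginary part, and whether it belongs to
    the first vector. *)
Definition cell (Q : nat) (y u : 'cV[F]_n) :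
    {ffun 'I_n * bool * bool -> 'I_(2 * Q).+1} :=
  [ffun k => grid Q (coordF k.1.2 ((if k.2 then y else u) k.1.1 0))].

Lemma entry_le_sqn (y : 'cV[F]_n) k : nsq (y k 0) <= sqn y.
Proof.
by rewrite /sqn (bigD1 k)//= lerDl sumr_ge0// => j _; exact: nsq_ge0.
Qed.

Lemma same_cell_close Q (y u y' u' : 'cV[F]_n) : (0 < Q)%N ->
  orthonormal2 y u -> orthonormal2 y' u' -> cell Q y u = cell Q y' u' ->
  sqn (y - y') <= 2 * n%:R / Q%:R ^+ 2 /\ sqn (u - u') <= 2 * n%:R / Q%:R ^+ 2.
Proof.
move=> Q0 [ny nu _] [ny' nu' _] /ffunP ce.
suff close (x x' : 'cV[F]_n) : sqn x = 1 -> sqn x' = 1 ->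
    (forall k im, grid Q (coordF im (x k 0)) = grid Q (coordF im (x' k 0))) ->
    sqn (x - x') <= 2 * n%:R / Q%:R ^+ 2.
  split; apply: close => // k im; first by have := ce (k, im, true); rewrite !ffunE.
  by have := ce (k, im, false); rewrite !ffunE.
move=> nx nx' ge.
have -> : 2 * n%:R / Q%:R ^+ 2 = \sum_(k < n) (2 * Q%:R ^- 2) :> R.
  by rewrite sumr_const card_ord -[RHS]mulr_natr mulrAC.
apply: ler_sum => k _; rewrite !mxE nsq_re_im mulr_natl mulr2n.
have ent im : (coordF im (x k 0) - coordF im (x' k 0)) ^+ 2 <= Q%:R ^- 2.
  by apply: grid_close => //; apply: coordF_le1;
    rewrite (le_trans (entry_le_sqn _ _)) ?nx ?nx'.
by have := lerD (ent false) (ent true); rewrite -!coordFB.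
Qed.

(** |a|^2 - |b|^2 is the real part of (a - b) times the conjugate of a + b. *)
Lemma nsq_diff_sq (a b : F) : (nsq a - nsq b) ^+ 2 <= nsq (a - b) * nsq (a + b).
Proof.
have -> : nsq a - nsq b = reF ((a - b) * conjF (a + b)).
  have -> : (a - b) * conjF (a + b) = embF (nsq a) - embF (nsq b) +
      (a * conjF b - conjF (a * conjF b)).
    by rewrite !nsqE rmorphD rmorphM /= conjFK; ring.
  by rewrite raddfD !raddfB /= !reF_emb reF_conj subrr addr0.
exact: re_sq_le.
Qed.

Lemma sq_close (Q : nat) (y y' : 'cV[F]_n) (x : vecF R K n) : (0 < Q)%N ->
  sqn y = 1 -> sqn y' = 1 -> sqn (x : 'cV[F]_n) = 1 ->
  sqn (y - y') <= 2 * n%:R / Q%:R ^+ 2 ->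
  `|sq y x - sq y' x| <= 3 * n%:R ^+ 2 / Q%:R.
Proof.
move=> Q0 ny ny' nx close.
have Q0' : 0 < Q%:R :> R by rewrite ltr0n.
have n0 : 0 <= n%:R :> R by [].
rewrite -(@ler_pXn2r _ 2) ?nnegrE ?divr_ge0 ?mulr_ge0 ?sqr_ge0//.
rewrite real_normK ?num_real// /sq -mulrBr exprMn.
have h1 : nsq (ip y x - ip y' x) <= 2 * n%:R / Q%:R ^+ 2.
  rewrite -ipNl -ipDl; apply: le_trans (cauchy_schwarz _ _) _.
  by rewrite nx mulr1.
have h2 : nsq (ip y x + ip y' x) <= 4.
  have : nsq (ip y x + ip y' x) <= 2 * (nsq (ip y x) + nsq (ip y' x)).
    by have := nsq_ge0 (ip y x - ip y' x); rewrite nsqB nsqD; lra.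
  have := cauchy_schwarz y x; have := cauchy_schwarz y' x.
  by rewrite ny ny' nx; lra.
apply: (@le_trans _ _ (n%:R ^+ 2 * (2 * n%:R / Q%:R ^+ 2 * 4))).
  rewrite ler_wpM2l ?sqr_ge0//; apply: le_trans (nsq_diff_sq _ _) _.
  by rewrite ler_pM ?nsq_ge0.
have -> : (3 * n%:R ^+ 2 / Q%:R) ^+ 2 = n%:R ^+ 2 * (9 * n%:R ^+ 2 / Q%:R ^+ 2) :> R.
  by field; rewrite gt_eqF.
rewrite ler_wpM2l ?sqr_ge0// mulrAC ler_wpM2r ?invr_ge0 ?sqr_ge0//.
have : n%:R <= n%:R ^+ 2 :> R.
  by rewrite expr2 -natrM ler_nat; case: (n) => // k; rewrite leq_pmulr.
by have := n0; lra.
Qed.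

End Net.

(** * Uniform law of large numbers over orthonormal pairs *)

Section UniformLaw.
Variables (R : realType) (K : base_field).
Local Notation F := (fieldF R K).

Section Sample.
Variables (n m : nat) (d : measure_display) (T : measurableType d).
Variables (P : probability T R) (z : 'I_m -> {RV P >-> vecF R K n}).
Hypothesis z_unif : forall i, uniform_on_sphere (distribution P (z i)).
Hypothesis z_indep : mutually_independent z.

(** The function is shifted by b to be nonnegative and sliced into L levels; the
    term 2 b / L is the slicing error. *)
Lemma pair_tail (g : R -> R -> R) (b e eta : R) (L : nat) (y u : 'cV[F]_n) :
  0 < b -> (forall s t, 0 <= s -> 0 <= t -> `|g s t| <= b) ->
  bmeas (fun x : vecF R K n => g (sq y x) (sq u x)) ->
  (forall i, e <= sphere_mean (distribution P (z i)) (fun x => g (sq y x) (sq u x))) ->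
  (0 < L)%N -> 0 < eta <= 2 ->
  exists Bad : set T, [/\ measurable Bad,
    (P Bad <= (L%:R * expR (- (eta ^+ 2 * m%:R / 4)))%:E)%E &
    forall w, ~ Bad w ->
      m%:R * (e - 2 * b / L%:R - 2 * b * eta) <=
      \sum_i g (sq y (z i w)) (sq u (z i w))].
Proof.
move=> b0 gb bg ge L0 eta01.
have L0' : 0 < L%:R :> R by rewrite ltr0n.
pose h := 2 * b / L%:R; have h0 : 0 < h by rewrite divr_gt0 ?mulr_gt0.
pose G (x : vecF R K n) := g (sq y x) (sq u x) + b.
have bG : bmeas G by apply: bmeasD bg _; exact: bmeas_cst.
have hL : h * L%:R = 2 * b by rewrite /h divfK ?gt_eqF.
have GL x : 0 <= G x <= h * L%:R.
  rewrite hL /G; have := gb _ _ (sq_ge0 y x) (sq_ge0 u x).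
  by rewrite ler_norml => /andP[h1 h2]; apply/andP; split; lra.
have G0 x : 0 <= G x by case/andP: (GL x).
have mG : measurable_fun setT G by case: bG.
have [Bad [mBad PBad goodP]] := bounded_sum_lower_tail z_indep L mG h0 G0 eta01.
exists Bad; split => // w /goodP.
have low i : e + b - h <= h * \sum_(l < L) fine (P [set w | level G h l (z i w)]).
  apply: le_trans (Ex_levels (z_unif i) bG h0 GL).
  rewrite lerD2r (ExD (z_unif i) bg (bmeas_cst K n b)) (Ex_cst (z_unif i)) lerD2r.
  exact: ge.
have low2 : m%:R * (e + b - h) <=
    h * \sum_(l < L) \sum_i fine (P [set w | level G h l (z i w)]).
  rewrite exchange_big mulr_sumr mulr_natl -[X in _ *+ X]card_ord -sumr_const.
  by apply: ler_sum => i _; exact: low.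
rewrite hL /G big_split /= sumr_const card_ord -(mulr_natl b).
rewrite -/h => h2; rewrite -(lerD2r (m%:R * b)).
apply: le_trans h2; have -> : m%:R * (e - h - 2 * b * eta) + m%:R * b =
  m%:R * (e + b - h) - 2 * b * eta * m%:R by ring.
by rewrite lerD2r.
Qed.

(** The tail bound at one orthonormal pair of the cell extends to all the others
    by the Lipschitz property: two pairs of a cell of mesh 1 / (q n^2) have squared
    coordinates at distance at most 3 / q. *)
Lemma cell_tail (g : R -> R -> R) (b c e eta : R) (L q : nat)
    (a : {ffun 'I_n * bool * bool -> 'I_(2 * (q * n ^ 2)).+1}) :
  (0 < n)%N -> (0 < q)%N -> (0 < m)%N -> 0 < b -> 0 <= c ->
  (forall s t, 0 <= s -> 0 <= t -> `|g s t| <= b) ->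
  (forall s t s' t', 0 <= s -> 0 <= t -> 0 <= s' -> 0 <= t' ->
    `|g s t - g s' t'| <= c * (`|s - s'| + `|t - t'|)) ->
  (forall y u, orthonormal2 y u ->
    bmeas (fun x : vecF R K n => g (sq y x) (sq u x)) /\
    forall i, e <= sphere_mean (distribution P (z i)) (fun x => g (sq y x) (sq u x))) ->
  (0 < L)%N -> 0 < eta <= 2 ->
  0 < e - 2 * b / L%:R - 2 * b * eta - 6 * c / q%:R ->
  exists Bad : set T, [/\ measurable Bad,
    (P Bad <= (L%:R * expR (- (eta ^+ 2 * m%:R / 4)))%:E)%E &
    forall w, ~ Bad w -> (forall i, sqn (z i w : 'cV[F]_n) = 1) ->
      forall y u, orthonormal2 y u -> cell (q * n ^ 2) y u = a ->
      0 < \sum_i g (sq y (z i w)) (sq u (z i w))].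
Proof.
move=> n0 q0 m0 b0 c0 gb gc ge L0 eta01 margin.
have [[y' [u' [on' ca']]]|none] := pselect (exists y u : 'cV[F]_n, orthonormal2 y u /\
    cell (q * n ^ 2) y u = a); last first.
  exists set0; split => // [|w _ _ y u on ca].
    by rewrite measure0 lee_fin mulr_ge0 ?expR_ge0.
  by exfalso; apply: none; exists y, u.
have [bg eg] := ge y' u' on'.
have [Bad [mBad PBad goodP]] := pair_tail b0 gb bg eg L0 eta01.
exists Bad; split => // w /goodP good zw y u on ca.
have Q0 : (0 < q * n ^ 2)%N by rewrite muln_gt0 q0 expn_gt0 n0.
have [cy cu] := same_cell_close Q0 on on' (etrans ca (esym ca')).
have [ny nu _] := on; have [ny' nu' _] := on'.
have q0' : 0 < q%:R :> R by rewrite ltr0n.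
have n0' : 0 < n%:R :> R by rewrite ltr0n.
have eps : 3 * n%:R ^+ 2 / (q * n ^ 2)%:R = 3 / q%:R :> R.
  by rewrite natrM natrX; field; rewrite !gt_eqF.
have diff i : g (sq y' (z i w)) (sq u' (z i w)) - 6 * c / q%:R <=
    g (sq y (z i w)) (sq u (z i w)).
  rewrite lerBlDr -lerBlDl.
  have := gc _ _ _ _ (sq_ge0 y' (z i w)) (sq_ge0 u' (z i w))
    (sq_ge0 y (z i w)) (sq_ge0 u (z i w)).
  move=> /(le_trans (ler_norm _)) h; apply: le_trans h _.
  have -> : 6 * c / q%:R = c * (3 / q%:R + 3 / q%:R) by field; rewrite gt_eqF.
  rewrite ler_wpM2l// lerD// -eps distrC; exact: sq_close.
apply: (@lt_le_trans _ _ (m%:R * (e - 2 * b / L%:R - 2 * b * eta - 6 * c / q%:R))).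
  by rewrite mulr_gt0 ?ltr0n.
apply: (@le_trans _ _ (\sum_i (g (sq y' (z i w)) (sq u' (z i w)) - 6 * c / q%:R))).
  by rewrite sumrB sumr_const card_ord -[X in _ <= _ - X]mulr_natl mulrBr lerD2r.
exact: ler_sum.
Qed.

End Sample.

(** All factors are turned into powers of n by k <= 2^k <= n^k. *)
Lemma net_card_le (n q L : nat) : (1 < n)%N -> (0 < q)%N ->
  (#|{ffun 'I_n * bool * bool -> 'I_(2 * (q * n ^ 2)).+1}| * L <=
    n ^ ((L + 12 * q + 8) * n))%N.
Proof.
move=> n1 q0; have n0 : (0 < n)%N by exact: ltnW.
have pow2 k : (k <= n ^ k)%N.
  case: k => // k; apply: leq_trans (ltnW (ltn_expl k.+1 (ltnSn 1))) _.
  by rewrite leq_exp2r.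
have base : ((2 * (q * n ^ 2)).+1 <= n ^ (3 * q + 2))%N.
  apply: (@leq_trans (3 * q * n ^ 2)).
    by rewrite -addn1 mulnA -mulnA -[X in (_ <= X)%N]mulnA (mulnDl 2 1) leq_add2l
      mul1n muln_gt0 q0 expn_gt0 n0.
  by rewrite expnD leq_mul.
have Ln : (L <= n ^ (L * n))%N.
  by apply: leq_trans (pow2 L) _; rewrite leq_exp2l// leq_pmulr.
rewrite card_ffun !card_prod card_bool !card_ord.
have -> : ((L + 12 * q + 8) * n = (3 * q + 2) * (n * 2 * 2) + L * n)%N by ring.
rewrite expnD; apply: leq_mul => //.
by rewrite [X in (_ <= X)%N]expnM leq_exp2r ?muln_gt0 ?n0.
Qed.

(** The bad event is the union of those of the cells of the net.  The constants
    depend on g and e only, neither on the dimension nor on the sample. *)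
Lemma uniform_law (g : R -> R -> R) (e : R) : 0 < e -> bounded_lipschitz g ->
  exists (N : nat) (rate : R), 0 < rate /\
  forall (n m : nat) (d : measure_display) (T : measurableType d)
    (P : probability T R) (z : 'I_m -> {RV P >-> vecF R K n}),
  (1 < n)%N -> (0 < m)%N ->
  (forall i, uniform_on_sphere (distribution P (z i))) ->
  mutually_independent z ->
  (forall y u, orthonormal2 y u ->
    bmeas (fun x : vecF R K n => g (sq y x) (sq u x)) /\
    forall i, e <= sphere_mean (distribution P (z i)) (fun x => g (sq y x) (sq u x))) ->
  exists Bad : set T, [/\ measurable Bad,
    (P Bad <= ((n ^ (N * n))%:R * expR (- (rate * m%:R)))%:E)%E &
    forall w, ~ Bad w -> (forall i, sqn (z i w : 'cV[F]_n) = 1) ->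
      forall y u, orthonormal2 y u ->
      0 < \sum_i g (sq y (z i w)) (sq u (z i w))].
Proof.
move=> e0 [b' [c [b0' c0 gb' gc]]].
pose b := b' + e + 1; have b0 : 0 < b by rewrite /b; lra.
have gb s t : 0 <= s -> 0 <= t -> `|g s t| <= b.
  by move=> s0 t0; apply: le_trans (gb' s t s0 t0) _; rewrite /b; lra.
pose L := (Num.truncn (8 * b / e)).+1.
pose q := (Num.truncn (24 * c / e)).+1.
pose eta := e / (8 * b).
have eb : e <= b by rewrite /b; lra.
have eta01 : 0 < eta <= 2.
  rewrite divr_gt0 ?mulr_gt0//= ler_pdivrMr ?mulr_gt0//; lra.
have hL : 2 * b / L%:R <= e / 4.
  have : 8 * b / e < L%:R by exact: truncnS_gt.
  by rewrite ltr_pdivrMr// => h; rewrite ler_pdivrMr ?ltr0n//; lra.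
have hq : 6 * c / q%:R <= e / 4.
  have : 24 * c / e < q%:R by exact: truncnS_gt.
  by rewrite ltr_pdivrMr// => h; rewrite ler_pdivrMr ?ltr0n//; lra.
have heta : 2 * b * eta = e / 4 by rewrite /eta; field; rewrite gt_eqF.
have margin : 0 < e - 2 * b / L%:R - 2 * b * eta - 6 * c / q%:R.
  by rewrite heta; move: hL hq e0; lra.
exists (L + 12 * q + 8)%N, (eta ^+ 2 / 4); split.
  by rewrite divr_gt0// exprn_gt0//; case/andP: eta01.
move=> n m d T P z n1 m0 z_unif z_indep ge.
have n0 : (0 < n)%N by exact: ltnW.
have L0 : (0 < L)%N by []. have q0 : (0 < q)%N by [].
have := fun a => @cell_tail n m d T P z z_unif z_indep g b c e eta L q a
  n0 q0 m0 b0 c0 gb gc ge L0 eta01 margin.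
move=> /choice[Bad BadP].
exists (\big[setU/set0]_(a <- enum
  {ffun 'I_n * bool * bool -> 'I_(2 * (q * n ^ 2)).+1}) Bad a).
split.
- by apply: bigsetU_measurable => a _; case: (BadP a).
- have := @bigsetU_le R _ T P _ (enum {ffun 'I_n * bool * bool -> 'I_(2 * (q * n ^ 2)).+1})
    Bad (L%:R * expR (- (eta ^+ 2 * m%:R / 4))) (fun a => _) (fun a => _).
  move=> /(_ (fun a => let: And3 x _ _ := BadP a in x)
             (fun a => let: And3 _ x _ := BadP a in x)).
  move=> /le_trans; apply; rewrite -cardE lee_fin mulrA -natrM.
  by rewrite (mulrAC _ m%:R) ler_wpM2r ?expR_ge0// ler_nat net_card_le.
- move=> w nBad zw y u on.
  have [_ _ /(_ w)] := BadP (cell (q * n ^ 2) y u); apply => //.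
  by move=> h; apply: nBad; rewrite -bigcup_seq; exists (cell (q * n ^ 2) y u);
    rewrite //= mem_enum.
Qed.

End UniformLaw.

(** * Recovery from random measurements *)

Section Recovery.
Variables (R : realType) (K : base_field).
Local Notation F := (fieldF R K).

Lemma hermitianP n (X : 'M[F]_n) : X \is hermitianmx n false conjF <-> adjF X = X.
Proof.
split; first by move/is_hermitianmxP; rewrite expr0 scale1r => {2}->.
by move=> Xh; apply/is_hermitianmxP; rewrite expr0 scale1r -[LHS]Xh.
Qed.

Lemma psdE n (X : 'M[F]_n) : psd X <-> forall v, 0 <= ip v (X *m v).
Proof. by split => h v; have := h v; rewrite /ip mulmxA. Qed.

Lemma measurementE n m (z : 'I_m -> 'cV[F]_n) X i :
  measurement z X 0 i = ip (z i) (X *m z i).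
Proof. by rewrite mxE /ip mulmxA. Qed.

Lemma rank1_form n (x v : 'cV[F]_n) : ip v (x *m adjF x *m v) = embF (nsq (ip x v)).
Proof. by rewrite rank1_mul ipZr nsqE ip_conj. Qed.

Lemma rank1_feasible n m (z : 'I_m -> 'cV[F]_n) (x : 'cV[F]_n) :
  let X0 := x *m adjF x in
  X0 \is hermitianmx n false conjF /\ psd X0 /\ measurement z X0 = measurement z X0.
Proof.
split; first by apply/hermitianP; rewrite adjFM adjFK.
split => //; apply/psdE => v; rewrite rank1_form -(rmorph0 (@embF R K)) embF_le.
exact: nsq_ge0.
Qed.

(** In dimension one the measurement is the only entry of the matrix. *)
Lemma recovery_dim1 m (z : 'I_m -> 'cV[F]_1) (X Y : 'M[F]_1) : (0 < m)%N ->
  (forall i, sqn (z i) = 1) -> measurement z X = measurement z Y -> X = Y.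
Proof.
move=> m0 zw /matrixP/(_ 0 (Ordinal m0)); rewrite !measurementE.
have form (A : 'M[F]_1) v : sqn v = 1 -> ip v (A *m v) = A 0 0.
  move=> v1; rewrite {1}[A]mx11_scalar mul_scalar_mx ipZr ip_self v1.
  by rewrite rmorph1 mulr1.
rewrite !form// => XY; rewrite [X]mx11_scalar [Y]mx11_scalar.
by rewrite XY.
Qed.

(** The vectors are rescaled by the square root of n, as in the tests. *)
Lemma recovery n m (z : 'I_m -> 'cV[F]_n) (A kap M : R) (x : 'cV[F]_n) (X : 'M[F]_n) :
  (1 < n)%N -> 0 < A -> 0 < kap -> 0 < M ->
  (forall y u, orthonormal2 y u ->
    0 < \sum_i trace_test A kap M (sq y (z i)) (sq u (z i))) ->
  (forall y u, orthonormal2 y u ->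
    0 < \sum_i sign_test kap M (sq y (z i)) (sq u (z i))) ->
  X \is hermitianmx n false conjF -> psd X ->
  measurement z X = measurement z (x *m adjF x) -> x *m adjF x = X.
Proof.
move=> n1 A0 kap0 M0 tr sg /hermitianP Xh /psdE Xp /matrixP Xz.
pose Z i := embF (Num.sqrt n%:R) *: z i.
have ZE y i : nsq (ip y (Z i)) = sq y (z i).
  by rewrite /Z ipZr nsqM nsq_emb sqr_sqrtr.
apply/esym; apply: (@psd_recovery R K n m Z A kap M) => //.
- by move=> y u on; under eq_bigr do rewrite !ZE; exact: tr.
- by move=> y u on; under eq_bigr do rewrite !ZE; exact: sg.
- move=> i; rewrite ZE /Z -scalemxAr ipZr ipZl conjF_emb mulrA -rmorphM -expr2.
  rewrite sqr_sqrtr//; have := Xz 0 i; rewrite !measurementE rank1_form => ->.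
  by rewrite -rmorphM.
Qed.

Lemma off_sphere_null (n m : nat) (d : measure_display) (T : measurableType d)
    (P : probability T R) (z : 'I_m -> {RV P >-> vecF R K n}) :
  (forall i, uniform_on_sphere (distribution P (z i))) ->
  exists Off : set T, [/\ measurable Off, P Off = 0%E &
    forall w, ~ Off w -> forall i, sqn (z i w : 'cV[F]_n) = 1].
Proof.
move=> z_unif; pose S := @unit_sphere R K n : set (vecF R K n).
pose off i := z i @^-1` (~` S).
have mS : measurable S by exact: unit_sphere_measurable.
have moff i : measurable (off i).
  have mz : measurable_fun setT (z i) by exact: measurable_funP.
  by rewrite -[off i]setTI; apply: mz => //; exact: measurableC.
have Poff i : (P (off i) <= 0%:E)%E.
  have -> : P (off i) = distribution P (z i) (~` S) by [].
  by rewrite probability_setC// (muS (z_unif i)) subee.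
exists (\big[setU/set0]_(i <- enum 'I_m) off i); split.
- by apply: bigsetU_measurable => i _.
- apply/eqP; rewrite eq_le measure_ge0 andbT.
  by have := bigsetU_le (enum 'I_m) moff Poff; rewrite mulr0.
- move=> w nw i; apply: contrapT => zi; apply: nw.
  rewrite -bigcup_seq; exists i; first by rewrite /= mem_enum.
  by rewrite /off /S unit_sphereE.
Qed.

Lemma union_complement_ge (d : measure_display) (T : measurableType d)
    (P : probability T R) (A B N : set T) (p : R) :
  measurable A -> measurable B -> measurable N -> P N = 0%E ->
  (P A + P B <= p%:E)%E -> ((1 - p)%:E <= P (~` (A `|` B `|` N)))%E.
Proof.
move=> mA mB mN PN PAB; have mAB : measurable (A `|` B) by exact: measurableU.
rewrite probability_setC; last exact: measurableU.
rewrite EFinB leeB//; apply: le_trans PAB.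
apply: le_trans (measureU2 _ _ _) _ => //.
rewrite [X in (_ + X <= _)%E](_ : _ = 0%E) ?adde0; last exact: PN.
exact: measureU2.
Qed.

(** The hypothesis on m says that n^(N n) <= exp(r m / 2), where N exceeds N1 and
    N2 by one, which leaves room for the factor 2. *)
Lemma failure_bound (n m N1 N2 : nat) (r1 r2 r : R) : (1 < n)%N ->
  0 < r -> r <= r1 -> r <= r2 ->
  2 * (maxn N1 N2).+1%:R / r * n%:R * ln n%:R <= m%:R ->
  (n ^ (N1 * n))%:R * expR (- (r1 * m%:R)) +
  (n ^ (N2 * n))%:R * expR (- (r2 * m%:R)) <= expR (- (r / 2 * m%:R / n%:R)).
Proof.
move=> n1 r0 rr1 rr2 mn; set N := (maxn N1 N2).+1 in mn.
have n0 : (0 < n)%N by exact: ltnW.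
have n0' : 0 < n%:R :> R by rewrite ltr0n.
have term k s : (k <= maxn N1 N2)%N -> r <= s -> (n ^ (k * n))%:R * expR (- (s * m%:R)) <=
    (n ^ (maxn N1 N2 * n))%:R * expR (- (r * m%:R)).
  move=> kN rs; rewrite ler_pM ?expR_ge0//.
    by rewrite ler_nat leq_exp2l// leq_mul2r kN orbT.
  by rewrite ler_expR lerN2 ler_wpM2r.
apply: le_trans (lerD (term _ _ (leq_maxl _ _) rr1) (term _ _ (leq_maxr _ _) rr2)) _.
rewrite -mulr2n -[X in X <= _]mulr_natl mulrA -natrM.
apply: (@le_trans _ _ ((n ^ (N * n))%:R * expR (- (r * m%:R)))).
  rewrite ler_wpM2r ?expR_ge0// ler_nat /N [(_.+1 * n)%N]mulSn expnD leq_mul//.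
  by apply: (leq_trans n1); rewrite -{1}(expn1 n) leq_exp2l.
have -> : (n ^ (N * n))%:R = expR (N%:R * n%:R * ln n%:R) :> R.
  by rewrite natrX -natrM expRM_natl lnK// posrE.
rewrite -expRD ler_expR.
have h1 : N%:R * n%:R * ln n%:R <= r / 2 * m%:R.
  have -> : N%:R * n%:R * ln n%:R = r / 2 * (2 * N%:R / r * n%:R * ln n%:R).
    by field; rewrite gt_eqF.
  by rewrite ler_wpM2l// divr_ge0// ltW.
have h2 : r / 2 * m%:R / n%:R <= r / 2 * m%:R.
  by rewrite ler_pdivrMr// ler_peMr ?mulr_ge0 ?divr_ge0 ?(ltW r0)// ler1n.
by move: h1 h2; lra.
Qed.

End Recovery.

Theorem theorem1 (R : realType) (K : base_field) :
  exists c gamma : R, 0 < c /\ 0 < gamma /\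
  forall n m : nat, (0 < n)%N -> (0 < m)%N ->
  c * n%:R * ln n%:R <= m%:R ->
  forall (x0 : 'cV[fieldF R K]_n)
    (d : measure_display) (T : measurableType d) (P : probability T R)
    (z : 'I_m -> {RV P >-> vecF R K n}),
  (forall i, uniform_on_sphere (distribution P (z i))) ->
  mutually_independent z ->
  let X0 := x0 *m adjF x0 in
  exists E : set T, measurable E /\
    ((1 - expR (- (gamma * m%:R / n%:R)))%:E <= P E)%E /\
    forall w, E w ->
      let A := measurement (fun i => z i w) in
      let b := A X0 in
      unique (fun X : 'M[fieldF R K]_n =>
                X \is hermitianmx n false conjF /\ psd X /\ A X = b) X0.
Proof.
(* The slack 1 - kap must be less than the bound 1/72 of [Ex_anticorrelation]. *)
pose kap : R := 1 - 100^-1; have kap0 : 0 < kap by rewrite /kap; lra.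
have e0 : 0 < 1000^-1 :> R by rewrite invr_gt0 ltr0n.
have M0 : 0 < 1000 :> R by rewrite ltr0n.
have A0 : 0 < 24 :> R by rewrite ltr0n.
have [N1 [r1 [r10 law1]]] :=
  uniform_law K e0 (bl_trace_test kap A0 (ltW M0)).
have [N2 [r2 [r20 law2]]] := uniform_law K e0 (bl_sign_test (ltW kap0) M0).
pose r := Num.min r1 r2; have r0 : 0 < r by rewrite lt_min r10.
pose N := (maxn N1 N2).+1.
exists (2 * N%:R / r), (r / 2); split; first by rewrite divr_gt0 ?mulr_gt0 ?ltr0n.
split; first by rewrite divr_gt0.
move=> n m n0 m0 mn x0 d T P z z_unif z_indep X0.
have [Off [mOff POff onS]] := off_sphere_null z_unif.
(* In dimension one there is no orthonormal pair, and log n = 0. *)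
have [n1|n1] := leqP n 1.
  have nE : n = 1%N by apply/eqP; rewrite eqn_leq n1.
  subst n; exists (~` Off); split; first exact: measurableC.
  split.
    rewrite probability_setC// POff sube0 lee_fin gerBl expR_ge0//.
  move=> w nw A b; split; first exact: rank1_feasible.
  by move=> X [_ [_ AX]]; apply: (recovery_dim1 m0 (onS w nw)).
have [B1 [mB1 PB1 good1]] : exists Bad : set T, [/\ measurable Bad,
    (P Bad <= ((n ^ (N1 * n))%:R * expR (- (r1 * m%:R)))%:E)%E &
    forall w, ~ Bad w -> (forall i, sqn (z i w : 'cV[fieldF R K]_n) = 1) ->
      forall y u, orthonormal2 y u ->
      0 < \sum_i trace_test 24 kap 1000 (sq y (z i w)) (sq u (z i w))].
  apply: law1 => // y u on; split; last by move=> i; exact: Ex_trace_test (z_unif i) n0 _ _ on.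
  by rewrite /trace_test; bmeas_tac.
have [B2 [mB2 PB2 good2]] : exists Bad : set T, [/\ measurable Bad,
    (P Bad <= ((n ^ (N2 * n))%:R * expR (- (r2 * m%:R)))%:E)%E &
    forall w, ~ Bad w -> (forall i, sqn (z i w : 'cV[fieldF R K]_n) = 1) ->
      forall y u, orthonormal2 y u ->
      0 < \sum_i sign_test kap 1000 (sq y (z i w)) (sq u (z i w))].
  apply: law2 => // y u on; split; last by move=> i; exact: Ex_sign_test (z_unif i) n0 _ _ on.
  by rewrite /sign_test; bmeas_tac.
exists (~` (B1 `|` B2 `|` Off)); split.
  by apply: measurableC; apply: measurableU => //; exact: measurableU.
split.
  apply: union_complement_ge => //; apply: le_trans (leeD PB1 PB2) _.
  rewrite -EFinD lee_fin; apply: failure_bound => //.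
    by rewrite /r ge_min lexx.
  by rewrite /r ge_min lexx orbT.
move=> w /not_orP[/not_orP[nB1 nB2] nOff] A b; split; first exact: rank1_feasible.
move=> X [Xh [Xp AX]]; apply: (recovery n1 A0 kap0 M0) Xh Xp AX.
- by move=> y u on; apply: good1 => //; exact: onS.
- by move=> y u on; apply: good2 => //; exact: onS.
Qed.
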